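(* Let $n\geq 3$ and let $\rho_{A_1A_2A_3}$ be a state (density matrix) on $H_{A_1}\otimes H_{A_2}\otimes H_{A_3}$ with $\dim H_{A_1}=\dim H_{A_2}=2$ and $\dim H_{A_3}=2^{n-2}$ (a $2\otimes 2\otimes 2^{n-2}$ state). Let $k\geq 1$, $\frac12\leq p\leq 1$, $r\geq 2$ and $0\leq \alpha\leq \frac r2$, and put $$l=\frac{(1+k)^{\alpha/r}-p^{\alpha/r}}{k^{\alpha/r}}.$$ (1) If $C^r(\rho_{A_1A_3})\geq k\,C^r(\rho_{A_1A_2})$, then $$C^\alpha(\rho_{A_1|A_2A_3})\geq p^{\alpha/r}C^\alpha(\rho_{A_1A_2})+l\,C^\alpha(\rho_{A_1A_3}).$$ (2) If $C^r(\rho_{A_1A_2})\geq k\,C^r(\rho_{A_1A_3})$, then $$C^\alpha(\rho_{A_1|A_2A_3})\geq p^{\alpha/r}C^\alpha(\rho_{A_1A_3})+l\,C^\alpha(\rho_{A_1A_2}).$$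
   Context: For a bipartite pure state $|\varphi\rangle_{XY}\in H_X\otimes H_Y$, its concurrence is $C(|\varphi\rangle)=\sqrt{2[1-\mathrm{tr}(\rho_X^2)]}$ where $\rho_X=\mathrm{tr}_Y|\varphi\rangle\langle\varphi|$. For a mixed bipartite state $\rho_{XY}$, $C(\rho_{XY})=\min\sum_i p_i C(|\varphi_i\rangle)$, the minimum over all pure-state ensembles $\{p_i,|\varphi_i\rangle\}$ with $\rho_{XY}=\sum_ip_i|\varphi_i\rangle\langle\varphi_i|$. $\rho_{A_1A_2}=\mathrm{tr}_{A_3}\rho_{A_1A_2A_3}$ and $\rho_{A_1A_3}=\mathrm{tr}_{A_2}\rho_{A_1A_2A_3}$ are reduced states, and $\rho_{A_1|A_2A_3}$ denotes $\rho_{A_1A_2A_3}$ regarded as a bipartite state with respect to the bipartition $A_1$ versus $A_2A_3$. $C^\alpha$ denotes the $\alpha$-th power of the concurrence. *)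

(* Defs.v *)
From HB Require Import structures.
From mathcomp Require Import all_boot all_order all_algebra.
From mathcomp Require Import complex.
From mathcomp Require Import all_classical all_reals.
From mathcomp Require Import exp.
Set Implicit Arguments. Unset Strict Implicit. Unset Printing Implicit Defensive.
Import Order.TTheory GRing.Theory Num.Theory.
Local Open Scope ring_scope.
Local Open Scope classical_set_scope.

(* Operators on a finite-dimensional Hilbert space C^I, with I a finite index type
   (computational basis indexed by I). *)
Definition op (R : realType) (I : finType) := I -> I -> R[i].

(* positive semidefinite: <v, M v> >= 0 (in the order of C, i.e. real and >= 0) *)
Definition psd (R : realType) (I : finType) (M : op R I) : Prop :=
  forall v : I -> R[i], 0 <= \sum_i \sum_j conjc (v i) * M i j * v j.

Definition trace (R : realType) (I : finType) (M : op R I) : R[i] := \sum_i M i i.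

Definition density (R : realType) (I : finType) (M : op R I) : Prop :=
  psd M /\ trace M = 1.

Definition unit_vec (R : realType) (I : finType) (v : I -> R[i]) : Prop :=
  \sum_i conjc (v i) * v i = 1.

Definition proj (R : realType) (I : finType) (v : I -> R[i]) : op R I :=
  fun i j => v i * conjc (v j).

Definition red_pure (R : realType) (X Y : finType) (phi : X * Y -> R[i]) : op R X :=
  fun x x' => \sum_y phi (x, y) * conjc (phi (x', y)).

Definition conc_pure (R : realType) (X Y : finType) (phi : X * Y -> R[i]) : R :=
  let rX := red_pure phi in
  Num.sqrt (2 * (1 - complex.Re (\sum_x \sum_x' rX x x' * rX x' x))).

Definition ensemble (R : realType) (I : finType)
    (rho : op R I) (e : seq (R * (I -> R[i]))) : Prop :=
  (forall q, q \in e -> 0 <= q.1 /\ unit_vec q.2) /\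
  \sum_(q <- e) q.1 = 1 /\
  (forall i j, rho i j = \sum_(q <- e) ((q.1)%:C)%C * proj q.2 i j).

Definition conc (R : realType) (X Y : finType) (rho : op R (X * Y)%type) : R :=
  inf [set s | exists e, ensemble rho e /\
                 s = \sum_(q <- e) q.1 * conc_pure q.2].

Section Tri.
Variables (R : realType) (A1 A2 A3 : finType).
Definition red12 (rho : op R (A1 * A2 * A3)%type) : op R (A1 * A2)%type :=
  fun x x' => \sum_c rho (x.1, x.2, c) (x'.1, x'.2, c).
Definition red13 (rho : op R (A1 * A2 * A3)%type) : op R (A1 * A3)%type :=
  fun x x' => \sum_b rho (x.1, b, x.2) (x'.1, b, x'.2).
Definition cut1 (rho : op R (A1 * A2 * A3)%type) : op R (A1 * (A2 * A3))%type :=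
  fun x x' => rho (x.1, x.2.1, x.2.2) (x'.1, x'.2.1, x'.2.2).
End Tri.

(* Main.v *)
(** Monogamy of the concurrence, C_12^2 + C_13^2 <= C_1|23^2, reduces the
    claim to the fact that s |-> (1 + s)^x - (p s)^x is nonincreasing on [0, 1]
    for x <= 1/2 <= p, together with the superadditivity of s |-> s^(r/2).

    By Minkowski's inequality, monogamy reduces to vectors phi. A vector of two
    qubits is a 2x2 matrix M, of concurrence 2 |det M|. Takagi's factorisation
    applied to the polar form of det gives an ensemble M_0, ..., M_3 of rho_12
    that is orthogonal for that form, with determinants l_0 >= ... >= l_3 >= 0;
    the vectors (M_0 +- i M_1) / sqrt 2 and (M_2 +- i M_3) / sqrt 2 then have
    total concurrence 2 (l_0 - l_1 + l_2 - l_3). When the l_i are positive,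
    the matrices M_0^-1 M_i are, up to scalars, the quaternion units in some
    basis, which yields a traceless Hermitian H with eigenvalues 1 and -1 such
    that F = sum_i M_i H M_i^* satisfies - det F >= (l_0 - l_1 + l_2 - l_3)^2.
    Measuring the second qubit in the eigenbasis of H gives an ensemble of rho_13
    whose squared concurrence is at most 4 det rho_1 + 4 det F. Degenerate states
    are treated by adding e^2 1 to rho_12, which does not change F since
    tr H = 0. *)
Require Import Defs.
From HB Require Import structures.
From mathcomp Require Import all_boot all_order all_algebra.
From mathcomp Require Import complex.
From mathcomp Require Import all_classical all_reals.
From mathcomp Require Import topology normedtype derive realfun exp.
From mathcomp Require Import perm.
From mathcomp Require Import ring lra.
Set Implicit Arguments.
Unset Strict Implicit.
Unset Printing Implicit Defensive.
Import Order.TTheory GRing.Theory Num.Theory.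
Local Open Scope ring_scope.

Local Open Scope sesquilinear_scope.

Local Notation conjC := Num.conj.

(** * Takagi's factorisation and the spectral theorem for complex matrices *)

Section Takagi.
Variable C : numClosedFieldType.

Lemma rv_norm_ge0 n (v : 'rV[C]_n) : 0 <= (v *m v ^t*) 0 0.
Proof.
by rewrite mxE sumr_ge0 // => j _; rewrite !mxE mul_conjC_ge0.
Qed.

Lemma rv_norm_eq0 n (v : 'rV[C]_n) : ((v *m v ^t*) 0 0 == 0) = (v == 0).
Proof.
apply/idP/eqP => [|->]; last by rewrite mul0mx mxE.
rewrite mxE psumr_eq0 => [/allP v0|j _]; last by rewrite !mxE mul_conjC_ge0.
apply/rowP => j; have := v0 j (mem_index_enum _).
by rewrite !mxE mul_conjC_eq0 => /eqP.
Qed.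

Lemma conj_mxK m n (A : 'M[C]_(m, n)) : map_mx conjC (map_mx conjC A) = A.
Proof. by apply/matrixP => i j; rewrite !mxE conjCK. Qed.

(** The antilinear map sending x to x^* T has as its square the multiplication by the Hermitian
    matrix [A], which commutes with the projection [P] onto the complement of the rows of [V]. So
    [P] sends some eigenvector of [A] to a nonzero x with x [A] = s^2 x, and for w = x^* T the
    vector w + s x is mapped to s times itself. *)
Lemma takagi_step n k (T : 'M[C]_n) (V : 'M[C]_(k, n)) (lam : 'rV[C]_k) :
  T^T = T -> (k < n)%N -> V *m V ^t* = 1%:M ->
  map_mx conjC V *m T = diag_mx lam *m V -> (forall i, 0 <= lam 0 i) ->
  exists (y : 'rV[C]_n) (l : C),
    [/\ y *m V ^t* = 0, (y *m y ^t*) 0 0 = 1,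
        map_mx conjC y *m T = l *: y & 0 <= l].
Proof.
move=> symT ltkn VV VT lam0.
have lamR : map_mx conjC (diag_mx lam) = diag_mx lam.
  apply/matrixP => i j; rewrite !mxE rmorphMn /=; congr (_ *+ _).
  by apply/CrealP; rewrite ger0_real.
pose A := map_mx conjC T *m T.
have AH : A ^t* = A.
  by rewrite /A trmx_mul map_mxM /= map_trmx !symT conj_mxK.
have VcT : V *m map_mx conjC T = diag_mx lam *m map_mx conjC V.
  by rewrite -{1}(conj_mxK V) -map_mxM VT map_mxM lamR.
have VA : V *m A = diag_mx lam *m diag_mx lam *m V.
  by rewrite /A mulmxA VcT -mulmxA VT mulmxA.
pose Q := V ^t* *m V.
have QH : Q ^t* = Q by rewrite /Q trmx_mul map_mxM /= trmxCK.
have QA : Q *m A = A *m Q.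
  have QAE : Q *m A = V ^t* *m (diag_mx lam *m diag_mx lam) *m V.
    by rewrite /Q -mulmxA VA !mulmxA.
  have : (Q *m A) ^t* = Q *m A.
    rewrite QAE !trmx_mul !map_mxM /= trmxCK tr_diag_mx lamR.
    by rewrite !mulmxA.
  by rewrite trmx_mul map_mxM /= AH QH.
pose P := 1%:M - Q.
have PA : P *m A = A *m P by rewrite /P mulmxBl mulmxBr QA mul1mx mulmx1.
have PV : P *m V ^t* = 0.
  by rewrite /P mulmxBl mul1mx /Q -mulmxA VV mulmx1 subrr.
(* [Q] factors through dimension [k] < [n], so it cannot be the identity. *)
have P0 : P != 0.
  apply/eqP => /eqP; rewrite /P subr_eq0 => /eqP Q1.
  have : (\rank (1%:M : 'M[C]_n) <= k)%N.
    by rewrite Q1 /Q (leq_trans (mxrankM_maxr _ _)) // rank_leq_row.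
  by rewrite mxrank1 leqNgt ltkn.
have Anorm : A \is normalmx.
  by apply/normalmxP; rewrite AH.
have /orthomx_spectralP AE := Anorm.
set U := spectralmx A in AE; set D := spectral_diag A in AE.
have Uunit : U \in unitmx by exact: spectral_unit.
have UA : U *m A = diag_mx D *m U by rewrite {1}AE !mulmxA mulmxV // mul1mx.
have [j xn0] : exists j, row j U *m P != 0.
  apply/existsP; apply: contraNT P0; rewrite negb_exists => /forallP H.
  have UP0 : U *m P = 0.
    apply/row_matrixP => j; rewrite row_mul row0.
    by apply/eqP; move: (H j); rewrite negbK.
  by rewrite -(mul1mx P) -(mulVmx Uunit) -mulmxA UP0 mulmx0.
set x := row j U *m P in xn0.
have xA : x *m A = D 0 j *: x.
  rewrite /x -mulmxA PA mulmxA -row_mul UA row_mul.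
  by rewrite row_diag_mx -!scalemxAl -rowE.
have xV : x *m V ^t* = 0 by rewrite /x -mulmxA PV mulmx0.
pose w := map_mx conjC x *m T.
have wT : map_mx conjC w *m T = D 0 j *: x.
  by rewrite /w map_mxM conj_mxK -mulmxA -/A xA.
have wV : w *m V ^t* = 0.
  have -> : w *m V ^t* = map_mx conjC (x *m V ^t*) *m diag_mx lam.
    have TV : T *m V ^t* = map_mx conjC (V ^t*) *m diag_mx lam.
      have := congr1 trmx VT; rewrite !trmx_mul symT tr_diag_mx map_trmx => ->.
      by rewrite conj_mxK.
    by rewrite /w -mulmxA TV mulmxA -map_mxM.
  by rewrite xV map_mx0 mul0mx.
have D0 : 0 <= D 0 j.
  have : 0 <= D 0 j * (x *m x ^t*) 0 0.
    have -> : D 0 j * (x *m x ^t*) 0 0 = (x *m A *m x ^t*) 0 0.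
      by rewrite xA -scalemxAl [RHS]mxE.
    have -> : x *m A *m x ^t* = (x *m map_mx conjC T) *m (x *m map_mx conjC T) ^t*.
      rewrite [in RHS]trmx_mul map_mxM /= map_trmx symT conj_mxK /A !mulmxA //.
    exact: rv_norm_ge0.
  by rewrite pmulr_lge0 // lt_def rv_norm_ge0 rv_norm_eq0 xn0.
pose s := sqrtC (D 0 j).
have s0 : 0 <= s by rewrite sqrtC_ge0.
have sR : s^* = s by apply/CrealP; rewrite ger0_real.
have [y [yn0 yV yT]] : exists y : 'rV[C]_n,
    [/\ y != 0, y *m V ^t* = 0 & map_mx conjC y *m T = s *: y].
  (* If w = - s x, antilinearity repairs the sign: 'i x is mapped to s 'i x. *)
  have [e|e] := eqVneq (w + s *: x) 0.
    exists ('i *: x); split.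
    - by rewrite scalemx_eq0 negb_or neq0Ci.
    - by rewrite -scalemxAl xV scaler0.
    - rewrite map_mxZ /= -scalemxAl -/w conjCi.
      move/eqP: e; rewrite addr_eq0 => /eqP ->.
      by rewrite scalerN scaleNr opprK scalerA mulrC -scalerA.
  exists (w + s *: x); split => //.
  - by rewrite mulmxDl -scalemxAl wV xV scaler0 addr0.
  - rewrite map_mxD map_mxZ /= mulmxDl -scalemxAl wT -/w sR.
    rewrite -(sqrtCK (D 0 j)) -/s scalerDr addrC scalerA //.
pose N := (y *m y ^t*) 0 0.
have N0 : 0 < N by rewrite lt_def rv_norm_ge0 rv_norm_eq0 yn0.
pose m := (sqrtC N)^-1.
have m0 : 0 < m by rewrite invr_gt0 sqrtC_gt0.
have mR : m^* = m by apply/CrealP; rewrite gtr0_real.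
exists (m *: y), s; split => //.
- by rewrite -scalemxAl yV scaler0.
- rewrite linearZ /= map_mxZ /= mR -scalemxAl -scalemxAr scalerA mxE -/N.
  by rewrite /m -invfM -expr2 sqrtCK mulVf // gt_eqF.
- by rewrite map_mxZ /= mR -scalemxAl yT !scalerA mulrC.
Qed.

Lemma takagi_partial n (T : 'M[C]_n) k : T^T = T -> (k <= n)%N ->
  exists (V : 'M[C]_(k, n)) (lam : 'rV[C]_k),
    [/\ V *m V ^t* = 1%:M, map_mx conjC V *m T = diag_mx lam *m V
      & forall i, 0 <= lam 0 i].
Proof.
move=> symT; elim: k => [_|k IH ltkn].
  exists 0, 0; split; last by case.
  - by apply/matrixP => -[].
  - by apply/matrixP => -[].
have [V [lam [VV VT lam0]]] := IH (ltnW ltkn).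
have [y [l [yV yy yT l0]]] := takagi_step symT ltkn VV VT lam0.
have VV' : col_mx y V *m (col_mx y V) ^t* = 1%:M.
  rewrite tr_col_mx map_row_mx mul_col_row yV VV.
  have -> : V *m y ^t* = 0.
    by rewrite -[LHS]trmxCK trmx_mul map_mxM /= trmxCK yV trmx0 map_mx0.
  by rewrite [y *m _]mx11_scalar yy -scalar_mx_block.
have VT' : map_mx conjC (col_mx y V) *m T =
    diag_mx (row_mx (l%:M : 'M_1) lam) *m col_mx y V.
  rewrite map_col_mx mul_col_mx VT yT diag_mx_row mul_block_col.
  rewrite !mul0mx addr0 add0r; congr col_mx.
  have -> : diag_mx (l%:M : 'M_1) = l%:M.
    by apply/matrixP => i j; rewrite !mxE !ord1.
  by rewrite mul_scalar_mx.
exists (col_mx y V : 'M_(1 + k, n)), (row_mx (l%:M : 'M_1) lam : 'M_(1, 1 + k)).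
split => // i; rewrite mxE; case: splitP => j _ //.
by rewrite !mxE !ord1 eqxx mulr1n.
Qed.

(* Takagi's factorisation: a coneigenbasis of the antilinear map
   x |-> x^* T, whose square is linear and positive. *)
Lemma takagi n (T : 'M[C]_n) : T^T = T ->
  exists (W : 'M[C]_n) (lam : 'rV[C]_n),
    [/\ W *m W ^t* = 1%:M, W *m T *m W^T = diag_mx lam
      & forall i, 0 <= lam 0 i].
Proof.
move=> symT; have [V [lam [VV VT lam0]]] := takagi_partial symT (leqnn n).
exists (map_mx conjC V), lam; split => //.
- by rewrite map_trmx -map_mxM /= VV map_mx1.
- by rewrite VT -mulmxA map_trmx VV mulmx1.
Qed.

Lemma hermitian_spectral n (A : 'M[C]_n) : A ^t* = A ->
  exists (U : 'M[C]_n) (D : 'rV[C]_n),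
    U *m U ^t* = 1%:M /\ A = U ^t* *m diag_mx D *m U.
Proof.
move=> AH; have /orthomx_spectralP AE : A \is normalmx by apply/normalmxP; rewrite AH.
exists (spectralmx A), (spectral_diag A).
have Uu := spectral_unitarymx A; split; first by apply/unitarymxP.
by rewrite -(invmx_unitary Uu).
Qed.
End Takagi.

(** * Two-by-two matrices: the polar form of the determinant and quaternion units *)

Section TracelessDirection.
Variable C : numClosedFieldType.
Implicit Types (A B P : 'M[C]_2) (x y : 'cV[C]_2).

Definition mx2 (a b c d : C) : 'M[C]_2 :=
  \matrix_(i, j) (if i == 0 then if j == 0 then a else b
                  else if j == 0 then c else d).

(** The symmetric bilinear form of the quadratic form det: det (A + B) = det A + [polar A B] + det
    B. *)
Definition polar A B : C :=
  A 0 0 * B 1 1 + B 0 0 * A 1 1 - (A 0 1 * B 1 0 + B 0 1 * A 1 0).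

Lemma I2P (i : 'I_2) : i = 0 \/ i = 1.
Proof.
by case: i => -[|[|//]] Hi; [left|right]; apply: val_inj.
Qed.

Lemma mx2P A B : A 0 0 = B 0 0 -> A 0 1 = B 0 1 -> A 1 0 = B 1 0 ->
  A 1 1 = B 1 1 -> A = B.
Proof.
by move=> *; apply/matrixP => i j; case: (I2P i) => ->; case: (I2P j) => ->.
Qed.

Lemma cv2P x y : x 0 0 = y 0 0 -> x 1 0 = y 1 0 -> x = y.
Proof.
by move=> *; apply/matrixP => i j; rewrite (ord1 j); case: (I2P i) => ->.
Qed.

Lemma sum2 (V : zmodType) (F : 'I_2 -> V) : \sum_i F i = F 0 + F 1.
Proof.
rewrite big_ord_recl big_ord1; congr (_ + F _); exact: val_inj.
Qed.

Lemma mulmx2E m n (A : 'M[C]_(m, 2)) (B : 'M[C]_(2, n)) i j :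
  (A *m B) i j = A i 0 * B 0 j + A i 1 * B 1 j.
Proof. by rewrite mxE sum2. Qed.

Lemma det2 A : \det A = A 0 0 * A 1 1 - A 0 1 * A 1 0.
Proof.
rewrite (expand_det_row _ 0) sum2 /cofactor !det_mx11 !mxE /= expr0 mul1r.
rewrite expr1 mulN1r mulrN.
by congr (_ * A _ _ - _ * A _ _); apply: val_inj.
Qed.

Lemma trace2 A : \tr A = A 0 0 + A 1 1.
Proof. by rewrite /mxtrace sum2. Qed.

(** Cayley-Hamilton for trace 0 and determinant 1. *)
Lemma traceless_sq P : \tr P = 0 -> \det P = 1 -> P *m P = - 1%:M.
Proof.
rewrite trace2 det2 => /eqP; rewrite addr_eq0 => /eqP e00 eD.
by apply: mx2P; rewrite !mulmx2E !mxE /= -?eD ?e00; ring.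
Qed.

(** Polarising A^2 = - det A, which holds for traceless A, gives A B + B A = - [polar A B]. *)
Lemma traceless_anticomm A B : \tr A = 0 -> \tr B = 0 -> polar A B = 0 ->
  A *m B = - (B *m A).
Proof.
rewrite !trace2 /polar => /eqP + /eqP; rewrite !addr_eq0.
move=> /eqP eA /eqP eB; rewrite eA eB => eP.
apply: mx2P; rewrite !mxE !sum2 ?eA ?eB.
- by apply/eqP; rewrite -subr_eq0 -oppr_eq0 -eP; apply/eqP; ring.
- by ring.
- by ring.
- by apply/eqP; rewrite -subr_eq0 -oppr_eq0 -eP; apply/eqP; ring.
Qed.

Lemma cv2_dependent x y : x != 0 -> x 0 0 * y 1 0 = x 1 0 * y 0 0 ->
  exists t, y = t *: x.
Proof.
move=> x0 e; have [x00|x00] := eqVneq (x 0 0) 0.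
  have x10 : x 1 0 != 0.
    by apply: contraNneq x0 => x10; apply/eqP/cv2P; rewrite mxE.
  exists (y 1 0 / x 1 0); apply: cv2P; rewrite mxE.
    move/esym/eqP: e; rewrite x00 mul0r mulf_eq0 (negPf x10) => /eqP ->.
    by rewrite mulr0.
  by field.
exists (y 0 0 / x 0 0); apply: cv2P; rewrite mxE; first by field.
by apply: (mulfI x00); rewrite e; field.
Qed.

(** By Cramer's rule the determinant [d] of the pair x, y times any entry of [A] vanishes, so a
    nonzero [A] forces [d] = 0. *)
Lemma kernel_dependent A x y : A != 0 -> A *m x = 0 -> A *m y = 0 ->
  x 0 0 * y 1 0 = x 1 0 * y 0 0.
Proof.
move=> A0 Ax Ay.
have Axi i : A i 0 * x 0 0 + A i 1 * x 1 0 = 0 by rewrite -mulmx2E Ax mxE.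
have Ayi i : A i 0 * y 0 0 + A i 1 * y 1 0 = 0 by rewrite -mulmx2E Ay mxE.
apply/eqP; rewrite -subr_eq0; apply: contraNT A0 => d0.
set d := _ - _ in d0.
have A0i i : A i 0 = 0.
  apply: (mulIf d0); rewrite mul0r.
  transitivity (y 1 0 * (A i 0 * x 0 0 + A i 1 * x 1 0)
                - x 1 0 * (A i 0 * y 0 0 + A i 1 * y 1 0)); first by rewrite /d; ring.
  by rewrite Axi Ayi !mulr0 subr0.
have A1i i : A i 1 = 0.
  apply: (mulIf d0); rewrite mul0r.
  transitivity (x 0 0 * (A i 0 * y 0 0 + A i 1 * y 1 0)
                - y 0 0 * (A i 0 * x 0 0 + A i 1 * x 1 0)); first by rewrite /d; ring.
  by rewrite Axi Ayi !mulr0 subr0.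
by apply/eqP; apply: mx2P; rewrite ?A0i ?A1i mxE.
Qed.

(* Three anticommuting square roots of -1 act on a basis x, y = P1 x of
   eigenvectors of P3 as the Pauli matrices do, up to the sign of c. *)
Lemma quaternion_frame P1 P2 P3 :
  P1 *m P1 = - 1%:M -> P2 *m P2 = - 1%:M -> P3 *m P3 = - 1%:M ->
  \tr P3 = 0 ->
  P1 *m P2 = - (P2 *m P1) -> P1 *m P3 = - (P3 *m P1) ->
  P2 *m P3 = - (P3 *m P2) ->
  exists x y c,
    [/\ x 0 0 * y 1 0 - x 1 0 * y 0 0 != 0, c ^+ 2 = -1
      & [/\ P3 *m x = 'i *: x, P3 *m y = - 'i *: y, P1 *m x = y & P1 *m y = - x]
        /\ (P2 *m x = c *: y /\ P2 *m y = c *: x)].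
Proof.
move=> P11 P22 P33 tr3 P12 P13 P23.
have two0 : (2 : C) != 0 by rewrite pnatr_eq0.
have i0 : ('i : C) != 0 by exact: neq0Ci.
have ii : 'i * 'i = -1 :> C by rewrite -expr2 sqrCi.
have tr_scalar (a : C) : P3 = a%:M -> a = 0.
  move=> e; move: tr3; rewrite e mxtrace_scalar => /eqP.
  by rewrite mulrn_eq0 /= => /eqP.
(* As P3^2 = -1, the nonzero columns of P3 + 'i are eigenvectors of P3 for 'i; they cannot all
   vanish, since the scalar - 'i has nonzero trace. *)
have [j xj0] : exists j, col j (P3 + 'i%:M) != 0.
  apply/existsP; apply: contraT; rewrite negb_exists => /forallP H.
  have : P3 + 'i%:M = 0.
    by apply/trmx_inj/row_matrixP => j; rewrite -tr_col;
      move: (H j); rewrite negbK => /eqP ->; rewrite !trmx0 row0.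
  move/eqP; rewrite addr_eq0 => /eqP e.
  have /tr_scalar/eqP : P3 = (- 'i)%:M by rewrite e raddfN.
  by rewrite oppr_eq0 (negPf i0).
set x := col j _ in xj0.
have xE : x = (P3 + 'i%:M) *m delta_mx j 0 by rewrite -colE.
have P3x : P3 *m x = 'i *: x.
  rewrite xE mulmxA mulmxDr P33 scalemxAl; congr (_ *m _).
  rewrite scalerDr scale_scalar_mx ii -raddfN /= addrC.
  by rewrite mul_mx_scalar.
pose y := P1 *m x.
have P1y : P1 *m y = - x by rewrite /y mulmxA P11 mulNmx mul1mx.
have P3y : P3 *m y = - 'i *: y.
  rewrite /y mulmxA -[P3 *m P1]opprK -P13 mulNmx -mulmxA P3x.
  by rewrite -scalemxAr scaleNr.
have d0 : x 0 0 * y 1 0 - x 1 0 * y 0 0 != 0.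
  apply/negP; rewrite subr_eq0 => /eqP /(cv2_dependent xj0) [t yE].
  have : P3 *m y = 'i *: y by rewrite yE -scalemxAr P3x !scalerA mulrC.
  rewrite P3y scaleNr => /eqP; rewrite eq_sym -addr_eq0 -mulr2n -scaler_nat.
  rewrite !scaler_eq0 (negPf two0) (negPf i0) /= => /eqP y0.
  move: P1y; rewrite y0 mulmx0 => /esym/eqP; rewrite oppr_eq0.
  by rewrite (negPf xj0).
(* P1 P2 commutes with P3, so P1 P2 x lies in the eigenspace of x, which is a line because P3 is not
   the scalar 'i. *)
have K0 : P3 - 'i%:M != 0.
  apply/negP; rewrite subr_eq0 => /eqP /tr_scalar/eqP; by rewrite (negPf i0).
have Kx : (P3 - 'i%:M) *m x = 0 by rewrite mulmxBl mul_scalar_mx P3x subrr.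
have Kw : (P3 - 'i%:M) *m (P1 *m P2 *m x) = 0.
  rewrite mulmxBl mul_scalar_mx !mulmxA.
  rewrite -[P3 *m P1]opprK -P13 !mulNmx -[P1 *m P3 *m P2]mulmxA.
  rewrite -[P3 *m P2]opprK -P23 mulmxN mulNmx opprK !mulmxA.
  by rewrite -[P1 *m P2 *m P3 *m x]mulmxA P3x -scalemxAr subrr.
have [t wE] := cv2_dependent xj0 (kernel_dependent K0 Kx Kw).
pose c := - t.
have P2x : P2 *m x = c *: y.
  have : P1 *m (P1 *m P2 *m x) = t *: y by rewrite wE -scalemxAr.
  rewrite !mulmxA P11 !mulNmx mul1mx => e.
  by rewrite -[LHS]opprK e scaleNr.
have P2y : P2 *m y = c *: x.
  rewrite /y mulmxA -[P2 *m P1]opprK -P12 mulNmx -mulmxA P2x -scalemxAr P1y.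
  by rewrite scalerN opprK.
exists x, y, c; split => //.
have : P2 *m (P2 *m x) = - x by rewrite mulmxA P22 mulNmx mul1mx.
rewrite P2x -scalemxAr P2y scalerA -expr2 => /eqP.
rewrite -[X in _ == X]scaleN1r -subr_eq0 -scalerBl scaler_eq0 (negPf xj0) orbF.
by rewrite subr_eq0 => /eqP.
Qed.
End TracelessDirection.

(** * Construction of the traceless Hermitian direction H *)

Section TracelessDirectionCore.
Variable C : numClosedFieldType.
Implicit Types (A B P : 'M[C]_2) (x y : 'cV[C]_2).

Definition adj2 A : 'M[C]_2 := mx2 (A 1 1) (- A 0 1) (- A 1 0) (A 0 0).

Lemma mul_adj2 A : A *m adj2 A = (\det A)%:M.
Proof. by rewrite det2; apply: mx2P; rewrite mulmx2E !mxE /=; ring. Qed.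

Lemma trace_adj2_mul A B : \tr (adj2 A *m B) = polar A B.
Proof. by rewrite trace2 /polar !mulmx2E !mxE /=; ring. Qed.

Lemma det_adj2 A : \det (adj2 A) = \det A.
Proof. by rewrite !det2 !mxE /=; ring. Qed.

Lemma polar_mul A B B' : polar (A *m B) (A *m B') = \det A * polar B B'.
Proof. by rewrite det2 /polar !mulmx2E; ring. Qed.

Lemma polarZ a b A B : polar (a *: A) (b *: B) = a * b * polar A B.
Proof. by rewrite /polar !mxE; ring. Qed.

(** B Z B^* for B = (x | y) and Z the Hermitian matrix with zero diagonal and off-diagonal entry z.
    In a quaternion frame every M_i H M_i^* keeps this shape over the same two vectors, so that only
    the coefficients have to be added. *)
Definition herm2 (z : C) x y : 'M[C]_2 :=
  z *: (x *m y ^t*) + z^* *: (y *m x ^t*).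

Lemma herm2E z x y i j :
  herm2 z x y i j = z * (x i 0 * (y j 0)^*) + z^* * (y i 0 * (x j 0)^*).
Proof. by rewrite !mxE !big_ord1 !mxE. Qed.

Lemma herm2_hermitian z x y : (herm2 z x y) ^t* = herm2 z x y.
Proof.
apply/matrixP => i j; rewrite [in LHS]mxE [in LHS]mxE !herm2E.
by rewrite rmorphD !rmorphM /= !conjCK; ring.
Qed.

Lemma herm2_conj A z x y :
  A *m herm2 z x y *m A ^t* = herm2 z (A *m x) (A *m y).
Proof.
rewrite /herm2 mulmxDr mulmxDl -!scalemxAr -!scalemxAl.
by rewrite !trmx_mul !map_mxM /= !mulmxA.
Qed.

Lemma herm2Z z a b x y : herm2 z (a *: x) (b *: y) = herm2 (z * a * b^*) x y.
Proof.
apply/matrixP => i j; rewrite !herm2E !mxE !rmorphM /= conjCK; ring.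
Qed.

Lemma herm2_swap z x y : herm2 z y x = herm2 z^* x y.
Proof. by apply/matrixP => i j; rewrite !herm2E conjCK addrC. Qed.

Lemma herm2D z z' x y : herm2 z x y + herm2 z' x y = herm2 (z + z') x y.
Proof. by apply/matrixP => i j; rewrite mxE !herm2E rmorphD /=; ring. Qed.

Lemma det_herm2 z x y :
  \det (herm2 z x y) = - (`|z| * `|x 0 0 * y 1 0 - x 1 0 * y 0 0|) ^+ 2.
Proof.
rewrite det2 !herm2E exprMn !normCK rmorphB !rmorphM /=; ring.
Qed.

Lemma trace_herm2 z x y (s := (y 0 0)^* * x 0 0 + (y 1 0)^* * x 1 0) :
  \tr (herm2 z x y) = z * s + (z * s)^*.
Proof.
by rewrite trace2 !herm2E /s !rmorphM rmorphD !rmorphM /= !conjCK; ring.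
Qed.

(** Making z s purely imaginary kills the trace of a [herm2] matrix; this only constrains the phase
    of z, while |z| remains free to fix the determinant. *)
Lemma exists_traceless_phase (s : C) (rho : C) : 0 <= rho ->
  exists z, `|z| = rho /\ z * s + (z * s)^* = 0.
Proof.
move=> rho0; have [->|s0] := eqVneq s 0.
  by exists rho; rewrite ger0_norm // !mulr0 rmorph0 addr0.
have rhoR : rho^* = rho by apply/CrealP; rewrite ger0_real.
exists (rho * 'i * (s^* / `|s|)); split.
  rewrite !normrM normCi normfV norm_conjC normr_id ger0_norm //.
  by rewrite mulfV ?normr_eq0 // !mulr1.
have -> : rho * 'i * (s^* / `|s|) * s = rho * 'i * `|s|.
  transitivity (rho * 'i * ((s^* * s) / `|s|)); first by ring.
  by rewrite -normCKC expr2 mulfK ?normr_eq0.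
have nR : `|s|^* = `|s| by apply/CrealP; rewrite normr_real.
by rewrite !rmorphM /= rhoR nR conjCi mulrN mulNr subrr.
Qed.

Lemma sqr_eqN1_norm (c : C) : c ^+ 2 = -1 -> c * c^* = 1.
Proof.
by move=> c2; apply/eqP; rewrite -normCK -normrX c2 normrN1.
Qed.

(** In the quaternion frame x, y take H = [herm2 z x y]. Over M_0 x and M_0 y the four terms have
    coefficients z, - (l1 / l0) z^*, (l2 / l0) z^* and - (l3 / l0) z, of sum [w] with [l0 * w] = (l0
    - l3) z - (l1 - l2) z^*. With |z| |d| = 1, the reverse triangle inequality bounds |w l0 d| below
    by l0 - l1 + l2 - l3 for any phase of z, which is thus free to make H traceless. *)
Lemma exists_traceless_direction (M0 M1 M2 M3 : 'M[C]_2)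
    (l0 l1 l2 l3 : C) :
  \det M0 = l0 -> \det M1 = l1 -> \det M2 = l2 -> \det M3 = l3 ->
  0 < l3 -> l3 <= l2 -> l2 <= l1 -> l1 <= l0 ->
  polar M0 M1 = 0 -> polar M0 M2 = 0 -> polar M0 M3 = 0 ->
  polar M1 M2 = 0 -> polar M1 M3 = 0 -> polar M2 M3 = 0 ->
  exists H : 'M[C]_2, [/\ H ^t* = H, \tr H = 0, \det H = -1 &
    (l0 - l1 + l2 - l3) ^+ 2 <=
    - \det (M0 *m H *m M0 ^t* + M1 *m H *m M1 ^t* +
            M2 *m H *m M2 ^t* + M3 *m H *m M3 ^t*)].
Proof.
move=> d0 d1 d2 d3 l3_gt0 l32 l21 l10 p01 p02 p03 p12 p13 p23.
have l2_gt0 : 0 < l2 by exact: lt_le_trans l32.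
have l1_gt0 : 0 < l1 by exact: lt_le_trans l21.
have l0_gt0 : 0 < l0 by exact: lt_le_trans l10.
(* [P l M] is M_0^-1 M rescaled to determinant 1; its trace is a multiple of [polar M0 M]. *)
pose P l (M : 'M[C]_2) := (sqrtC l0 * sqrtC l)^-1 *: (adj2 M0 *m M).
have sq (l : C) : 0 < l -> sqrtC l != 0 by move=> h; rewrite gt_eqF // sqrtC_gt0.
have sK (l : C) : sqrtC l * sqrtC l = l by rewrite -expr2 sqrtCK.
have trP l M : polar M0 M = 0 -> \tr (P l M) = 0.
  by move=> h; rewrite mxtraceZ trace_adj2_mul h mulr0.
have detP (l : C) M : \det M = l -> 0 < l -> \det (P l M) = 1.
  move=> dM lp; rewrite detZ det_mulmx det_adj2 d0 dM exprVn exprMn !sqrtCK.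
  by rewrite mulVf // mulf_neq0 // gt_eqF.
have polP l l' M M' : polar M M' = 0 -> polar (P l M) (P l' M') = 0.
  by move=> h; rewrite polarZ polar_mul h !mulr0.
have MP (l : C) M (v : 'cV[C]_2) : 0 < l -> M *m v = (sqrtC l / sqrtC l0) *: (M0 *m (P l M *m v)).
  move=> lp; rewrite /P -scalemxAl -scalemxAr scalerA !mulmxA mul_adj2 d0.
  rewrite mul_scalar_mx -scalemxAl scalerA.
  have -> : sqrtC l / sqrtC l0 * (sqrtC l0 * sqrtC l)^-1 * l0 = 1.
    by rewrite -{3}(sK l0); field; rewrite !sq.
  by rewrite scale1r.
have [x [y [c [dxy c2 [[P3x P3y P1x P1y] [P2x P2y]]]]]] :
  exists x y c,
    [/\ x 0 0 * y 1 0 - x 1 0 * y 0 0 != 0, c ^+ 2 = -1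
      & [/\ P l3 M3 *m x = 'i *: x, P l3 M3 *m y = - 'i *: y,
            P l1 M1 *m x = y & P l1 M1 *m y = - x]
        /\ (P l2 M2 *m x = c *: y /\ P l2 M2 *m y = c *: x)].
  apply: quaternion_frame; rewrite ?traceless_sq ?trP ?detP //.
  - by apply: traceless_anticomm; rewrite ?trP ?polP.
  - by apply: traceless_anticomm; rewrite ?trP ?polP.
  - by apply: traceless_anticomm; rewrite ?trP ?polP.
set d := _ - _ in dxy.
have rho0 : 0 <= `|d|^-1 by rewrite invr_ge0.
have [z [zn zs]] := exists_traceless_phase
  ((y 0 0)^* * x 0 0 + (y 1 0)^* * x 1 0) rho0.
have dn0 : `|d| != 0 by rewrite normr_eq0.
exists (herm2 z x y); split.
- exact: herm2_hermitian.
- by rewrite trace_herm2.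
- by rewrite det_herm2 zn mulVf // expr1n.
set X := M0 *m x; set Y := M0 *m y.
pose m l := sqrtC l / sqrtC l0.
have mR (l : C) : 0 < l -> (m l)^* = m l.
  by move=> h; apply/CrealP; rewrite ger0_real // divr_ge0 ?sqrtC_ge0 ?ltW.
have mm (l : C) : m l * m l = l / l0.
  by rewrite /m mulrACA sK -invfM sK.
have {}MP (l : C) M (v : 'cV[C]_2) :
  0 < l -> M *m v = m l *: (M0 *m (P l M *m v)) by exact: MP.
clearbody m.
have E1 : M1 *m herm2 z x y *m M1 ^t* = herm2 (- (l1 / l0) * z^*) X Y.
  rewrite herm2_conj (MP l1 M1 x) // (MP l1 M1 y) // P1x P1y mulmxN -/X -/Y.
  rewrite -[- X]scaleN1r scalerA herm2Z herm2_swap; congr herm2.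
  rewrite !rmorphM /= rmorphN1 !conjCK mR // -mm; ring.
have E2 : M2 *m herm2 z x y *m M2 ^t* = herm2 (l2 / l0 * z^*) X Y.
  rewrite herm2_conj (MP l2 M2 x) // (MP l2 M2 y) // P2x P2y -!scalemxAr -/X -/Y.
  rewrite !scalerA herm2Z herm2_swap; congr herm2.
  rewrite !rmorphM /= !conjCK mR // -mm.
  transitivity (m l2 * m l2 * z^* * (c * c^*)); first by ring.
  by rewrite sqr_eqN1_norm // mulr1.
have E3 : M3 *m herm2 z x y *m M3 ^t* = herm2 (- (l3 / l0) * z) X Y.
  rewrite herm2_conj (MP l3 M3 x) // (MP l3 M3 y) // P3x P3y -!scalemxAr -/X -/Y.
  rewrite !scalerA herm2Z; congr herm2.
  rewrite !rmorphM rmorphN /= conjCi mR // -mm.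
  transitivity (m l3 * m l3 * z * ('i * 'i)); first by ring.
  by rewrite -(expr2 'i) sqrCi; ring.
rewrite herm2_conj -/X -/Y E1 E2 E3 !herm2D det_herm2 opprK.
set w := (X in `|X|).
have -> : X 0 0 * Y 1 0 - X 1 0 * Y 0 0 = l0 * d.
  by rewrite /X /Y !mulmx2E -d0 det2 /d; ring.
have k0 : 0 <= l0 - l1 + l2 - l3.
  by rewrite -addrA addr_ge0 // subr_ge0.
have w0 : 0 <= `|w| * `|l0 * d| by rewrite mulr_ge0.
rewrite lerXn2r ?nnegrE //.
have l0N : `|l0| = l0 by rewrite ger0_norm // ltW.
rewrite normrM l0N.
have wE : l0 * w = (l0 - l3) * z - (l1 - l2) * z^*.
  by rewrite /w; field; rewrite gt_eqF.
have l30 : l3 <= l0 by rewrite (le_trans l32) // (le_trans l21).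
have H1 : `|(l0 - l3) * z| - `|(l1 - l2) * z^*| <= `|l0 * w|.
  by rewrite wE; exact: lerB_dist.
rewrite !normrM norm_conjC zn l0N [`|l0 - l3|]ger0_norm ?subr_ge0 // in H1.
rewrite [`|l1 - l2|]ger0_norm ?subr_ge0 // in H1.
have dp : 0 < `|d| by rewrite normr_gt0.
move: H1; rewrite -mulrBl ler_pdivrMr //.
rewrite [l0 * `|w|]mulrC mulrA; apply: le_trans.
by rewrite le_eqVlt; apply/orP; left; apply/eqP; ring.
Qed.
End TracelessDirectionCore.

(** * Sorted Takagi values and the spectral decomposition of positive operators *)

Section SpectralFamilies.

Lemma takagi_sorted (C : numClosedFieldType) n (T : 'I_n -> 'I_n -> C) :
  (forall k l, T k l = T l k) ->
  exists (w : 'I_n -> 'I_n -> C) (lam : 'I_n -> C),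
    [/\ forall i j, \sum_k w i k * (w j k)^* = (i == j)%:R,
        forall k l, \sum_i w i k * (w i l)^* = (k == l)%:R,
        forall i j, \sum_k \sum_l w i k * w j l * T k l = lam i *+ (i == j),
        forall i, 0 <= lam i
      & forall i j : 'I_n, (i <= j)%N -> lam j <= lam i].
Proof.
move=> symT; pose A : 'M[C]_n := \matrix_(i, j) T i j.
have [|W [lam [WW WT lam0]]] := @takagi _ _ A.
  by apply/matrixP => i j; rewrite !mxE symT.
pose t : n.-tuple C := [tuple lam 0 i | i < n].
pose le' (x y : C) := y <= x.
have t0 : all (>= 0) t.
  by apply/allP => _ /mapP[i _ ->].
(* The order is total on the nonnegative numbers but not on all of [C], so the sorting is confined
   to the former. *)
have srt : sorted le' (sort le' t).
  apply: (@sort_sorted_in _ (>= 0)) => // x y x0 y0.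
  by rewrite /le' orbC; exact: ger_leVge.
have [p pE] : exists p : 'S_n, sort le' t = [tuple tnth t (p i) | i < n].
  by apply/tuple_permP; rewrite perm_sort.
have lamE i : lam 0 (p i) = nth 0 (sort le' t) i.
  by rewrite pE -tnth_nth !tnth_mktuple.
exists (fun i => W (p i)), (fun i => lam 0 (p i)); split.
- move=> i j; have := congr1 (fun M : 'M_n => M (p i) (p j)) WW.
  rewrite !mxE (inj_eq perm_inj) => <-.
  by apply: eq_bigr => k _; rewrite !mxE.
- move=> k l; have := mulmx1C WW => /(congr1 (fun M : 'M_n => M l k)).
  rewrite !mxE eq_sym => <-.
  rewrite [RHS](reindex_inj (@perm_inj _ p)).
  by apply: eq_bigr => i _; rewrite !mxE mulrC.
- move=> i j; have := congr1 (fun M : 'M_n => M (p i) (p j)) WT.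
  rewrite [RHS]mxE (inj_eq perm_inj) => <-.
  rewrite mxE exchange_big; apply: eq_bigr => l _.
  rewrite !mxE mulr_suml; apply: eq_bigr => k _.
  by rewrite !mxE mulrAC.
- by [].
- move=> i j ij; rewrite !lamE.
  have trans : transitive le' by move=> y x z /= xy yz; exact: le_trans yz xy.
  have := sorted_leq_nth trans (@lexx _ C) 0 srt.
  by move/(_ i j); rewrite !inE size_sort size_tuple /le' => ->.
Qed.

Section Psd.
Variables (R : realType) (I : finType).
Local Notation C := R[i].
Implicit Type M : op R I.

Lemma conjcE (x : C) : conjc x = x^*. Proof. by []. Qed.

(** Polarisation: the form is real at e_i + e_j and at e_i + 'i e_j, and this determines [M j i]
    from [M i j]. *)
Lemma psd_hermitian M : psd M -> forall i j, (M i j)^* = M j i.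
Proof.
move=> psdM.
pose q (v w : I -> C) := \sum_i \sum_j (v i)^* * M i j * w j.
have qDr v w w' : q v (fun i => w i + w' i) = q v w + q v w'.
  rewrite /q -big_split; apply: eq_bigr => i _; rewrite -big_split.
  by apply: eq_bigr => j _; rewrite mulrDr.
have qDl v w w' : q (fun i => w i + w' i) v = q w v + q w' v.
  rewrite /q -big_split; apply: eq_bigr => i _; rewrite -big_split.
  by apply: eq_bigr => j _; rewrite rmorphD /= !mulrDl.
pose d (a : C) (i : I) := fun k : I => a *+ (k == i).
have qd a b i j : q (d a i) (d b j) = a^* * b * M i j.
  rewrite /q (bigD1 i) //= (bigD1 j) //= !big1 ?addr0.
  - by rewrite /d !eqxx !mulr1n mulrAC.
  - move=> k ki; rewrite big1 // => l _.
    by rewrite /d (negPf ki) mulr0n rmorph0 !mul0r.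
  - by move=> l lj; rewrite /d (negPf lj) mulr0n mulr0.
have qreal a b i j : a^* * b * M i j + b^* * a * M j i \is Num.real.
  have h v : q v v \is Num.real by rewrite ger0_real //; exact: psdM.
  have := h (fun k => d a i k + d b j k).
  rewrite qDr !qDl !qd.
  have := h (d a i); have := h (d b j); rewrite !qd => h1 h2.
  have -> : a^* * a * M i i + b^* * a * M j i + (a^* * b * M i j + b^* * b * M j j) =
    (a^* * a * M i i + b^* * b * M j j) + (a^* * b * M i j + b^* * a * M j i) by ring.
  by rewrite rpredDl // rpredD.
move=> i j.
have /CrealP := qreal 1 1 i j; have /CrealP := qreal 1 'i i j.
rewrite !rmorphD !rmorphM /= !conjCK !conjCi !rmorph1 !mul1r !mulr1.
move=> e1 e2.
have i0 : ('i : C) != 0 by exact: neq0Ci.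
have two0 : (2 : C) != 0 by rewrite pnatr_eq0.
apply: (mulfI two0); apply: (mulfI i0).
have -> : 'i * (2 * (M i j)^*) =
  'i * ((M i j)^* + (M j i)^*) - (- 'i * (M i j)^* + 'i * (M j i)^*) by ring.
by rewrite e1 e2; ring.
Qed.

(** The spectral theorem transported along [enum_val]. As [A] = U^* D U, the eigenvectors are the
    conjugated rows of [U]. *)
Lemma psd_spectral M n : #|I| = n -> psd M ->
  exists (u : 'I_n -> I -> C) (r : 'I_n -> R),
    [/\ forall k, 0 <= r k,
        forall k l, \sum_i u k i * (u l i)^* = (k == l)%:R,
        forall i j, \sum_k u k i * (u k j)^* = (i == j)%:R
      & forall i j, M i j = \sum_k (r k)%:C%C * (u k i * (u k j)^*)].
Proof.
move=> <- psdM.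
pose A : 'M[C]_#|I| := \matrix_(i, j) M (enum_val i) (enum_val j).
have [|U [D [UU AE]]] := @hermitian_spectral _ _ A.
  by apply/matrixP => i j; rewrite !mxE psd_hermitian.
have UU' := mulmx1C UU.
have DE : diag_mx D = U *m A *m U ^t*.
  by rewrite AE !mulmxA UU mul1mx -mulmxA UU mulmx1.
have D0 k : 0 <= D 0 k.
  have := congr1 (fun B : 'M_#|I| => B k k) DE.
  rewrite mxE eqxx mulr1n => ->.
  have := psdM (fun i => (U k (enum_rank i))^*); congr (0 <= _).
  rewrite mxE exchange_big [RHS](reindex _ (onW_bij _ (@enum_rank_bij I))).
  apply: eq_bigr => j _.
  rewrite mxE mulr_suml [RHS](reindex _ (onW_bij _ (@enum_rank_bij I))).
  by apply: eq_bigr => i _; rewrite !mxE !enum_rankK conjcE conjCK.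
exists (fun k i => (U k (enum_rank i))^*), (fun k => complex.Re (D 0 k)); split.
- by move=> k; have := D0 k; rewrite lecE => /andP[].
- move=> k l; have := congr1 (fun B : 'M_#|I| => B l k) UU.
  rewrite !mxE eq_sym => <-.
  rewrite [RHS](reindex _ (onW_bij _ (@enum_rank_bij I))).
  by apply: eq_bigr => i _; rewrite !mxE conjCK mulrC.
- move=> i j.
  have := congr1 (fun B : 'M_#|I| => B (enum_rank i) (enum_rank j)) UU'.
  rewrite !mxE (inj_eq enum_rank_inj) => <-.
  by apply: eq_bigr => k _; rewrite !mxE conjCK.
- move=> i j.
  have := congr1 (fun B : 'M_#|I| => B (enum_rank i) (enum_rank j)) AE.
  rewrite !mxE !enum_rankK => ->.
  apply: eq_bigr => k _; rewrite mul_mx_diag !mxE conjCK RRe_real ?ger0_real //.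
  by rewrite mulrA [D 0 k * _]mulrC.
Qed.
End Psd.
End SpectralFamilies.

(** * Unitary mixing of ensembles and perturbation estimates for determinants *)

Section EnsembleDirection.

(** Unitary freedom of ensembles: for [a], [b] the coordinates of a family of vectors at two places,
    the mixed family has the same sum of projectors. *)
Lemma unitary_mix (C : numClosedFieldType) n (w : 'I_n -> 'I_n -> C)
    (a b : 'I_n -> C) :
  (forall k l, \sum_i w i k * (w i l)^* = (k == l)%:R) ->
  \sum_i (\sum_k w i k * a k) * (\sum_k w i k * b k)^* = \sum_k a k * (b k)^*.
Proof.
move=> ww.
transitivity (\sum_k \sum_l (\sum_i w i k * (w i l)^*) * (a k * (b l)^*)).
  under eq_bigr => i _.
    rewrite rmorph_sum mulr_suml.
    under eq_bigr => k _ do rewrite mulr_sumr.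
    over.
  rewrite exchange_big; apply: eq_bigr => k _.
  rewrite exchange_big; apply: eq_bigr => l _.
  rewrite mulr_suml; apply: eq_bigr => i _.
  by rewrite rmorphM /= mulrACA.
apply: eq_bigr => k _; under eq_bigr => l _ do rewrite ww.
rewrite (bigD1 k) //= eqxx mul1r big1 ?addr0 // => l lk.
by rewrite eq_sym (negPf lk) mul0r.
Qed.

Lemma unitary_le1 (C : numClosedFieldType) (I J : finType) (w : I -> J -> C) :
  (forall i j, \sum_k w i k * (w j k)^* = (i == j)%:R) ->
  forall i k, `|w i k| <= 1.
Proof.
move=> ww i k.
have : \sum_k w i k * (w i k)^* = 1 by rewrite ww eqxx.
rewrite (bigD1 k) //= -normCK => e.
rewrite -(@ler_pXn2r _ 2) ?nnegrE // expr1n -e lerDl.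
by apply: sumr_ge0 => j _; rewrite -normCK exprn_ge0.
Qed.

Lemma norm_comb_le (C : numClosedFieldType) n (w u a : 'I_n -> C) (K : C) :
  (forall k, `|w k| <= 1) -> (forall k, `|u k| <= 1) ->
  (forall k, `|a k| <= K) -> `|\sum_k w k * (a k * u k)| <= K *+ n.
Proof.
move=> w1 u1 aK; apply: (le_trans (ler_norm_sum _ _ _)).
rewrite -[n in K *+ n]card_ord -sumr_const; apply: ler_sum => k _.
rewrite !normrM -[K]mul1r -[K]mulr1 ler_pM ?mulr_ge0 // ler_pM //.
Qed.

Section Polar.
Variable C : numClosedFieldType.
Implicit Types (A B : 'M[C]_2).

Lemma polarC A B : polar A B = polar B A.
Proof. by rewrite /polar; ring. Qed.

Lemma polar_self A : polar A A = 2 * \det A.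
Proof. by rewrite det2 /polar; ring. Qed.

Lemma polarDr A B B' : polar A (B + B') = polar A B + polar A B'.
Proof. by rewrite /polar !mxE; ring. Qed.

Lemma polar_sumr n A (z : 'I_n -> C) (B : 'I_n -> 'M[C]_2) :
  polar A (\sum_k z k *: B k) = \sum_k z k * polar A (B k).
Proof.
have p0 : polar A 0 = 0 by rewrite /polar !mxE; ring.
rewrite (big_morph _ (polarDr A) p0); apply: eq_bigr => k _.
by rewrite /polar !mxE; ring.
Qed.

Lemma polar_sum n (z z' : 'I_n -> C) (B : 'I_n -> 'M[C]_2) :
  polar (\sum_k z k *: B k) (\sum_k z' k *: B k) =
  \sum_k \sum_l z k * z' l * polar (B k) (B l).
Proof.
rewrite polarC polar_sumr; apply: eq_bigr => k _.
rewrite polarC polar_sumr mulr_sumr; apply: eq_bigr => l _.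
by rewrite mulrA.
Qed.

Lemma polar_delta A i j : polar A (delta_mx i j) = 0 -> A (1 - i) (1 - j) = 0.
Proof.
by case: (I2P i) => ->; case: (I2P j) => ->; rewrite /polar !mxE /=
  ?subr0 ?subrr ?(mulr0, mulr1, mul0r, mul1r, addr0, add0r, subr0, sub0r) //
  => /eqP; rewrite ?oppr_eq0 => /eqP.
Qed.

Lemma polar_nondegenerate A : (forall i j, polar A (delta_mx i j) = 0) -> A = 0.
Proof.
move=> H; have E i j := polar_delta (H i j).
have e00 := E 1 1; have e01 := E 1 0; have e10 := E 0 1; have e11 := E 0 0.
by apply: mx2P; rewrite mxE; move: e00 e01 e10 e11; rewrite ?subrr ?subr0.
Qed.

(** Replacing the entries of A one at a time by those of B leaves four error terms of size at most
    [K * eta]. *)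
Lemma norm_det_perturb A B (eta K : C) :
  (forall i j, `|A i j - B i j| <= eta) ->
  (forall i j, `|A i j| <= K) -> (forall i j, `|B i j| <= K) ->
  `|\det A| <= `|\det B| + 4 * (K * eta).
Proof.
move=> AB AK BK.
have -> : \det A = \det B + ((A 0 0 - B 0 0) * A 1 1 + B 0 0 * (A 1 1 - B 1 1)
   + - ((A 0 1 - B 0 1) * A 1 0) + - (B 0 1 * (A 1 0 - B 1 0))).
  by rewrite !det2; ring.
rewrite (le_trans (ler_normD _ _)) // lerD2l.
have -> : 4 * (K * eta) = eta * K + K * eta + eta * K + K * eta by ring.
do 3! (apply: (le_trans (ler_normD _ _)); apply: lerD;
       last by rewrite ?normrN normrM ler_pM).
by rewrite normrM ler_pM.
Qed.

(** For A and B orthogonal under [polar] and a = 1 / sqrt 2 the determinant is (det A - det B) / 2;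
    this is where the alternating sum of the l_i comes from. *)
Lemma det_addi A B a : \det (a *: (A + 'i *: B)) =
  a ^+ 2 * (\det A - \det B + 'i * polar A B).
Proof.
have ii : 'i * 'i = -1 :> C by rewrite -expr2 sqrCi.
rewrite !det2 /polar !mxE.
transitivity (a ^+ 2 * (A 0 0 * A 1 1 - A 0 1 * A 1 0 +
  ('i * 'i) * (B 0 0 * B 1 1 - B 0 1 * B 1 0) +
  'i * (A 0 0 * B 1 1 + B 0 0 * A 1 1 - (A 0 1 * B 1 0 + B 0 1 * A 1 0))));
  first by ring.
by rewrite ii; ring.
Qed.
End Polar.

(** Compares the square roots of an eigenvalue r of rho and of the eigenvalue r + e^2 of rho + e^2
    1. *)
Lemma sqrt_addsqr_bounds (R : realType) (r e : R) : 0 <= r -> 0 <= e ->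
  Num.sqrt r <= Num.sqrt (r + e ^+ 2) <= Num.sqrt r + e.
Proof.
move=> r0 e0; rewrite ler_sqrt ?lerDl ?sqr_ge0 //=; last by rewrite addr_ge0 ?sqr_ge0.
rewrite -[leRHS]ger0_norm ?addr_ge0 ?sqrtr_ge0 // -sqrtr_sqr ler_sqrt ?sqr_ge0 //.
rewrite sqrrD sqr_sqrtr // lerD2r lerDl.
by rewrite mulrn_wge0 // mulr_ge0 ?sqrtr_ge0.
Qed.
End EnsembleDirection.

(** * The orthogonal ensemble of a positive definite two-qubit operator *)

Section EnsembleDirectionMain.
Variable R : realType.
Local Notation C := R[i].
Local Notation AB := ('I_2 * 'I_2)%type.

Definition vmx (v : AB -> C) : 'M[C]_2 := \matrix_(a, b) v (a, b).

(** The vectors h (p + 'i q) and h (p - 'i q) have the same sum of projectors as p and q, written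
    here for one pair of entries. *)
Lemma parallelogram_i (h p q p' q' : C) : h * h^* = 2^-1 ->
  (h * (p + 'i * q)) * (h * (p' + 'i * q'))^* +
  (h * (p + 'i * (- q))) * (h * (p' + 'i * (- q')))^* = p * p'^* + q * q'^*.
Proof.
move=> hh; have ii : 'i * 'i = -1 :> C by rewrite -expr2 sqrCi.
rewrite !rmorphM !rmorphD !rmorphM !rmorphN /= conjCi.
transitivity ((h * h^*) * 2 * (p * p'^* - ('i * 'i) * (q * q'^*))); first by ring.
by rewrite hh ii mulVf ?pnatr_eq0 //; ring.
Qed.

(** Takagi's factorisation is applied to the Gram matrix of [polar] on the scaled eigenvectors
    [S k]; its diagonal entries are 2 det M_i. They are positive because the [S k] span all matrices
    and [polar] is nondegenerate. *)
Lemma exists_takagi_ensemble (u : 'I_4 -> AB -> C) (s : 'I_4 -> R) :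
  (forall k, 0 < s k) ->
  (forall k l, \sum_i u k i * (u l i)^* = (k == l)%:R) ->
  (forall i j, \sum_k u k i * (u k j)^* = (i == j)%:R) ->
  exists (w : 'I_4 -> 'I_4 -> C) (l : 'I_4 -> C),
    let M i : 'M[C]_2 := vmx (fun x => \sum_k w i k * ((s k)%:C%C * u k x)) in
    [/\ forall i j, \sum_k w i k * (w j k)^* = (i == j)%:R,
        forall k l, \sum_i w i k * (w i l)^* = (k == l)%:R,
        forall i, \det (M i) = l i /\ 0 < l i,
        forall i j : 'I_4, (i <= j)%N -> l j <= l i
      & forall i j, i != j -> polar (M i) (M j) = 0].
Proof.
move=> s0 uu uu'.
pose S k : 'M[C]_2 := vmx (fun x => (s k)%:C%C * u k x).
have [|w [lam [ww ww' wT lam0 lamS]]] := @takagi_sorted C 4 (fun k l => polar (S k) (S l)).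
  by move=> k l; rewrite polarC.
have two0 : (2 : C) != 0 by rewrite pnatr_eq0.
exists w, (fun i => lam i / 2) => M.
have ME i : M i = \sum_k w i k *: S k.
  apply/matrixP => a b; rewrite mxE summxE.
  by apply: eq_bigr => k _; rewrite !mxE.
have polM i j : polar (M i) (M j) = lam i *+ (i == j).
  by rewrite !ME polar_sum wT.
split => //.
- move=> i; split.
    apply: (mulfI two0); rewrite -polar_self polM eqxx mulr1n.
    by rewrite mulrCA mulfV // mulr1.
  rewrite divr_gt0 // lt_def lam0 andbT; apply/eqP => lami.
  (* A zero value makes M_i orthogonal to every M_j, hence to every [S k], hence to all matrices;
     then M_i = 0, and row [i] of the unitary [w] vanishes. *)
  have pS k : polar (M i) (S k) = 0.
    have -> : S k = \sum_j (w j k)^* *: M j.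
      under eq_bigr => j _ do rewrite ME scaler_sumr.
      rewrite exchange_big /=.
      transitivity (\sum_l (\sum_j w j l * (w j k)^*) *: S l).
        rewrite (bigD1 k) //= ww' eqxx scale1r big1 ?addr0 // => l lk.
        by rewrite ww' (negPf lk) scale0r.
      apply: eq_bigr => l _; rewrite scaler_suml; apply: eq_bigr => j _.
      by rewrite scalerA mulrC.
    rewrite polar_sumr big1 // => j _; rewrite polM lami.
    by rewrite mul0rn mulr0.
  have Mi0 : M i = 0.
    apply: polar_nondegenerate => a b.
    have -> : delta_mx a b = \sum_k ((u k (a, b))^* / (s k)%:C%C) *: S k.
      apply/matrixP => a' b'; rewrite summxE mxE.
      transitivity (\sum_k u k (a', b') * (u k (a, b))^*).
        by rewrite uu' -pair_eqE.
      apply: eq_bigr => k _; rewrite !mxE; field.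
      by rewrite (_ : 0 = (0 : R)%:C%C) // (inj_eq (@complexI R)) gt_eqF.
    by rewrite polar_sumr big1 // => k _; rewrite pS mulr0.
  have w0 l : w i l = 0.
    have sl0 : (s l)%:C%C != 0.
      by rewrite (_ : 0 = (0 : R)%:C%C) // (inj_eq (@complexI R)) gt_eqF.
    apply: (mulIf sl0); rewrite mul0r.
    transitivity (\sum_x M i x.1 x.2 * (u l x)^*); last first.
      by rewrite big1 // => x _; rewrite Mi0 mxE mul0r.
    under eq_bigr => x _ do rewrite mxE mulr_suml.
    rewrite exchange_big /=.
    transitivity (\sum_k w i k * (s k)%:C%C * (\sum_x u k x * (u l x)^*)); last first.
      apply: eq_bigr => k _; rewrite mulr_sumr; apply: eq_bigr => x _.
      by rewrite -surjective_pairing !mulrA.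
    under eq_bigr => k _ do rewrite uu.
    rewrite (bigD1 l) //= eqxx mulr1 big1 ?addr0 // => k kl.
    by rewrite (negPf kl) mulr0.
  have := ww i i; rewrite eqxx big1 => [/esym/eqP|k _]; last by rewrite w0 mul0r.
  by rewrite oner_eq0.
- by move=> i j ij; rewrite ler_pM2r ?invr_gt0 // lamS.
- by move=> i j ij; rewrite polM (negPf ij).
Qed.
End EnsembleDirectionMain.

(** * The ensemble and the direction H for an arbitrary positive two-qubit operator *)

Section EnsembleDirectionPsd.
Variable R : realType.
Local Notation C := R[i].
Local Notation AB := ('I_2 * 'I_2)%type.

Lemma conjC_real (x : R) : (x%:C%C : C)^* = x%:C%C.
Proof. exact: conjc_real. Qed.

Lemma normr_complex (x : R) : `|x%:C%C| = `|x|%:C%C.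
Proof. by rewrite normc_def /= expr0n addr0 sqrtr_sqr. Qed.

Lemma oppmxE (A : 'M[C]_2) a b : (- A) a b = - A a b.
Proof. by rewrite mxE. Qed.

Lemma det_opp2 (A : 'M[C]_2) : \det (- A) = \det A.
Proof. by rewrite !det2 !mxE; ring. Qed.

Lemma polarNr (A B : 'M[C]_2) : polar A (- B) = - polar A B.
Proof. by rewrite /polar !mxE; ring. Qed.

Lemma norm_pair_le (h p q c : C) : `|h| <= 1 -> `|p| <= c -> `|q| <= c ->
  `|h * (p + 'i * q)| <= c + c.
Proof.
move=> h1 pc qc; rewrite normrM -[c + c]mul1r ler_pM //.
by rewrite (le_trans (ler_normD _ _)) // lerD // normrM normCi mul1r.
Qed.

(** [X] and [Y] approximate an orthogonal pair [M], [N], for which [det_addi] gives exactly (l - m)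
    / 2. Paired entries are at most 2 c and move by at most 2 d, whence the error 4 (2 c) (2 d). *)
Lemma det_pair_le (h c d : C) (X Y M N : 'M[C]_2) (l m : C) :
  h ^+ 2 = 2^-1 -> \det M = l -> \det N = m -> polar M N = 0 -> m <= l ->
  (forall a b, `|X a b - M a b| <= d) -> (forall a b, `|Y a b - N a b| <= d) ->
  (forall a b, `|X a b| <= c) -> (forall a b, `|Y a b| <= c) ->
  (forall a b, `|M a b| <= c) -> (forall a b, `|N a b| <= c) ->
  `|\det (h *: (X + 'i *: Y))| <= (l - m) / 2 + 16 * (c * d).
Proof.
move=> h2 dM dN pMN ml XM YN Xc Yc Mc Nc.
have h1 : `|h| <= 1.
  rewrite -(@ler_pXn2r _ 2) ?nnegrE // expr1n -normrX h2 ger0_norm ?invr_ge0 //.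
  by rewrite invf_le1 ?ler1n // ltr0n.
have -> : (l - m) / 2 + 16 * (c * d) = (l - m) / 2 + 4 * ((c + c) * (d + d)) by ring.
have dE : `|\det (h *: (M + 'i *: N))| = (l - m) / 2.
  rewrite det_addi pMN mulr0 addr0 dM dN h2 mulrC ger0_norm //.
  by rewrite mulr_ge0 ?subr_ge0 // invr_ge0.
rewrite -dE; apply: norm_det_perturb => a b; rewrite !mxE.
- have -> : h * (X a b + 'i * Y a b) - h * (M a b + 'i * N a b) =
            h * ((X a b - M a b) + 'i * (Y a b - N a b)) by ring.
  exact: norm_pair_le.
- exact: norm_pair_le.
- exact: norm_pair_le.
Qed.

Lemma enum_I4 :
  exists i0 i1 i2 i3 : 'I_4,
    [/\ (i0 <= i1)%N, (i1 <= i2)%N, (i2 <= i3)%N,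
       [/\ i0 != i1, i0 != i2, i0 != i3, i1 != i2 & i1 != i3] /\ i2 != i3
     & forall (V : zmodType) (F : 'I_4 -> V), \sum_i F i = F i0 + F i1 + F i2 + F i3].
Proof.
exists 0, 1, 2, 3; split => // V F.
rewrite !big_ord_recr big_ord0 /= add0r.
by congr (F _ + F _ + F _ + F _); apply: val_inj.
Qed.

(** Takagi's ensemble is formed for rho + e^2 1, and its unitary [w] is then applied to the scaled
    eigenvectors of rho itself: the resulting [Xf] are an exact ensemble of rho, entrywise close to
    the M_i. Pairing them as in [det_addi] gives [s], with kap = l_0 - l_1 + l_2 - l_3. *)
Lemma exists_ensemble_direction (rho : op R AB) (delta : R) :
  psd rho -> 0 < delta ->
  exists (s : seq (AB -> C)) (H : 'M[C]_2) (kap : R),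
    [/\ forall x x', rho x x' = \sum_(v <- s) v x * (v x')^*,
        [/\ H ^t* = H, \tr H = 0 & \det H = -1],
        0 <= kap,
        \sum_(v <- s) `|\det (vmx v)| <= (kap + delta)%:C%C
      & (kap%:C%C) ^+ 2 <=
        - \det (\matrix_(a, a') \sum_b \sum_b' rho (a, b) (a', b') * H b b')].
Proof.
move=> psdrho delta0.
have card4 : #|{: AB}| = 4%N by rewrite card_prod !card_ord.
have [u [r [r0 uu uu' rhoE]]] := psd_spectral card4 psdrho.
pose t := \sum_k r k; have t0 : 0 <= t by apply: sumr_ge0.
have rt k : r k <= t by rewrite /t (bigD1 k) //= lerDl sumr_ge0.
(* [K] bounds every [s k]. Each of the four paired determinants is off by at most 16 (4 K) (4 e),
   which adds up to [1024 * K * e]. *)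
pose K := Num.sqrt (t + 1) + 1.
have K1 : 1 <= K by rewrite /K lerDr sqrtr_ge0.
pose e := Num.min 1 (delta / (1024 * K)).
have K0 : 0 < 1024 * K by lra.
have e0 : 0 < e by rewrite lt_min ltr01 divr_gt0.
have eK : 1024 * K * e <= delta.
  have : e <= delta / (1024 * K) by rewrite ge_min lexx orbT.
  by rewrite ler_pdivlMr // mulrC.
have e1 : e <= 1 by rewrite ge_min lexx.
pose s k := Num.sqrt (r k + e ^+ 2).
have s0 k : 0 < s k by rewrite sqrtr_gt0 ltr_wpDl // exprn_gt0.
have [w [l]] := exists_takagi_ensemble s0 uu uu'.
set M := fun i => _; cbv zeta => -[ww ww' detM lS polM].
have {}rs k := sqrt_addsqr_bounds (r0 k) (ltW e0).
have sK k : s k <= K.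
  have /andP[_ h] := rs k; apply: (le_trans h); apply: lerD => //.
  by rewrite ler_sqrt ?addr_ge0 // (le_trans (rt k)) // lerDl.
pose Xf i x := \sum_k w i k * ((Num.sqrt (r k))%:C%C * u k x).
pose X i : 'M[C]_2 := vmx (Xf i).
have w1 := unitary_le1 ww; have u1 := unitary_le1 uu.
have XM i a b : `|X i a b - M i a b| <= e%:C%C *+ 4.
  rewrite /X /M !mxE /Xf -sumrB.
  under eq_bigr => k _ do rewrite -mulrBr -mulrBl -rmorphB.
  apply: norm_comb_le => // k; rewrite normr_complex lecR distrC.
  have /andP[h1 h2] := rs k; rewrite ger0_norm ?subr_ge0 //.
  by rewrite lerBlDl.
have XK i a b : `|X i a b| <= K%:C%C *+ 4.
  rewrite /X mxE /Xf; apply: norm_comb_le => // k.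
  rewrite normr_complex lecR ger0_norm ?sqrtr_ge0 //.
  by have /andP[h1 _] := rs k; exact: le_trans h1 (sK k).
have MK i a b : `|M i a b| <= K%:C%C *+ 4.
  rewrite /M mxE; apply: norm_comb_le => // k.
  by rewrite normr_complex lecR ger0_norm ?sqrtr_ge0.
pose h : C := (sqrtC 2)^-1.
have h2 : h ^+ 2 = 2^-1 by rewrite /h exprVn sqrtCK.
have hh : h * h^* = 2^-1.
  have -> : h^* = h by apply/CrealP; rewrite ger0_real // invr_ge0 sqrtC_ge0 ler0n.
  by rewrite -expr2.
pose V i j (x : AB) : C := h * (Xf i x + 'i * Xf j x).
pose V' i j (x : AB) : C := h * (Xf i x + 'i * (- Xf j x)).
have [i0 [i1 [i2 [i3 [l01 l12 l23 [[n01 n02 n03 n12 n13] n23] sum4]]]]] := enum_I4.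
have [[d0 p0] [d1 p1]] := (detM i0, detM i1).
have [[d2 p2] [d3 p3]] := (detM i2, detM i3).
have [H [HH trH detH HF]] := exists_traceless_direction d0 d1 d2 d3 p3
  (lS _ _ l23) (lS _ _ l12) (lS _ _ l01) (polM _ _ n01) (polM _ _ n02)
  (polM _ _ n03) (polM _ _ n12) (polM _ _ n13) (polM _ _ n23).
set kapC := _ - _ in HF.
have kapC0 : 0 <= kapC.
  by rewrite /kapC -addrA addr_ge0 // subr_ge0 lS.
have kapE : (complex.Re kapC)%:C%C = kapC by rewrite RRe_real ?ger0_real.
exists [:: V i0 i1; V' i0 i1; V i2 i3; V' i2 i3], H, (complex.Re kapC).
have rhoM x x' : \sum_i (M i x.1 x.2) * (M i x'.1 x'.2)^* =
    rho x x' + (e ^+ 2)%:C%C * (x == x')%:R.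
  under eq_bigr => i _ do rewrite /M !mxE -!surjective_pairing.
  rewrite (unitary_mix _ _ ww') rhoE -uu' mulr_sumr -big_split.
  apply: eq_bigr => k _ /=.
  rewrite rmorphM /= conjC_real.
  have -> : (s k)%:C%C * u k x * ((s k)%:C%C * (u k x')^*) =
            ((s k)%:C%C * (s k)%:C%C) * (u k x * (u k x')^*) by ring.
  rewrite -rmorphM /= -expr2 sqr_sqrtr ?addr_ge0 ?sqr_ge0 //.
  by rewrite rmorphD /= mulrDl.
split => //.
- move=> x x'; rewrite !big_cons big_nil addr0 addrA !parallelogram_i //.
  have -> : rho x x' = \sum_i Xf i x * (Xf i x')^*.
    rewrite (unitary_mix _ _ ww') rhoE; apply: eq_bigr => k _.
    rewrite rmorphM /= conjC_real.
    rewrite -[X in X%:C%C * _](sqr_sqrtr (r0 k)) rmorphXn /=; ring.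
  by rewrite sum4 !addrA.
- by move: kapC0; rewrite -{1}kapE ler0c.
- rewrite !big_cons big_nil addr0 rmorphD /= kapE.
  have vV i j : vmx (V i j) = h *: (X i + 'i *: X j).
    by apply/matrixP => a b; rewrite !mxE.
  have vV' i j : vmx (V' i j) = h *: (X i + 'i *: (- X j)).
    by apply/matrixP => a b; rewrite !mxE.
  rewrite !vV !vV'.
  pose c : C := K%:C%C *+ 4; pose d : C := e%:C%C *+ 4.
  have B (i j : 'I_4) : i != j -> (i <= j)%N ->
      `|\det (h *: (X i + 'i *: X j))| <= (l i - l j) / 2 + 16 * (c * d).
    move=> nij lij; have [di _] := detM i; have [dj _] := detM j.
    exact: (det_pair_le h2 di dj (polM _ _ nij) (lS _ _ lij)).
  have B' (i j : 'I_4) : i != j -> (i <= j)%N ->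
      `|\det (h *: (X i + 'i *: (- X j)))| <= (l i - l j) / 2 + 16 * (c * d).
    move=> nij lij; have [di _] := detM i; have [dj _] := detM j.
    have djN : \det (- M j) = l j by rewrite det_opp2.
    have pN : polar (M i) (- M j) = 0.
      by rewrite polarNr polM // oppr0.
    apply: (det_pair_le h2 di djN pN (lS _ _ lij)) => //.
    + by move=> a b; rewrite 2!oppmxE -opprD normrN; exact: XM.
    + by move=> a b; rewrite oppmxE normrN; exact: XK.
    + by move=> a b; rewrite oppmxE normrN; exact: MK.
  apply: (@le_trans _ _ (kapC + (1024 * K * e)%:C%C)); last first.
    by rewrite lerD2l lecR.
  have -> : kapC + (1024 * K * e)%:C%C =
    ((l i0 - l i1) / 2 + 16 * (c * d)) + (((l i0 - l i1) / 2 + 16 * (c * d)) +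
    (((l i2 - l i3) / 2 + 16 * (c * d)) + ((l i2 - l i3) / 2 + 16 * (c * d)))).
    by rewrite /kapC !rmorphM rmorph_nat /= /c /d; field.
  apply: lerD; first exact: B.
  apply: lerD; first exact: B'.
  by apply: lerD; [exact: B|exact: B'].
- rewrite kapE; apply: (le_trans HF); rewrite le_eqVlt; apply/orP; left.
  apply/eqP; congr (- \det _); apply/matrixP => a a'.
  have -> : M i0 *m H *m M i0 ^t* + M i1 *m H *m M i1 ^t* +
      M i2 *m H *m M i2 ^t* + M i3 *m H *m M i3 ^t* =
      \sum_i M i *m H *m M i ^t* by rewrite sum4.
  rewrite summxE.
  transitivity (\sum_b \sum_b' (\sum_i M i a b * (M i a' b')^*) * H b b').
    rewrite !sum2 !sum4 !mulmx2E !mxE; ring.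
  rewrite [RHS]mxE.
  have rM b b' : \sum_i M i a b * (M i a' b')^* = rho (a, b) (a', b') +
    (e ^+ 2)%:C%C * ((a, b) == (a', b'))%:R by exact: rhoM (a, b) (a', b').
  move: trH; rewrite trace2 !sum2 !rM => trH.
  (* The shift by e^2 contributes e^2 tr H = 0 for a = a' and nothing otherwise. *)
  have [aa|na] := eqVneq a a'.
    rewrite -!pair_eqE /= aa ?eqxx /= !(mulr0, mulr1, addr0).
    by rewrite -[RHS]addr0 -[X in _ = _ + X](mulr0 (e ^+ 2)%:C%C) -trH; ring.
  by rewrite -!pair_eqE /= (negPf na) /= !(mulr0, addr0).
Qed.
End EnsembleDirectionPsd.

(** * Concurrence through the determinant of the reduced qubit state *)

Section Concurrence.
Variables (R : realType) (Y : finType).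
Local Notation C := R[i].
Implicit Types (v : 'I_2 * Y -> C) (rho : op R ('I_2 * Y)%type).

Definition det_red v : C :=
  red_pure v 0 0 * red_pure v 1 1 - red_pure v 0 1 * red_pure v 1 0.

(* Homogeneous extension of [conc_pure] from unit vectors to all vectors. *)
Definition conc_vec v : R := 2 * Num.sqrt (complex.Re (det_red v)).

Definition sqnorm v : C := \sum_i (v i)^* * v i.

Lemma sum_pairE (F : 'I_2 * Y -> C) : \sum_i F i = \sum_y F (0, y) + \sum_y F (1, y).
Proof.
transitivity (\sum_x \sum_y F (x, y)); last by rewrite sum2.
by rewrite pair_bigA; apply: eq_bigr => -[].
Qed.

Lemma conc_vec_ge0 v : 0 <= conc_vec v.
Proof. by rewrite mulr_ge0 ?sqrtr_ge0. Qed.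

(** Cauchy-Binet: the determinant is the sum of the squared moduli of the minors [m y z] over
    unordered pairs; summing over ordered pairs counts it twice. *)
Lemma det_red_ge0 v : 0 <= det_red v.
Proof.
pose m y z := v (0, y) * v (1, z) - v (0, z) * v (1, y).
have two0 : 0 < (2 : C) by rewrite ltr0n.
rewrite -(pmulr_rge0 _ two0).
suff -> : 2 * det_red v = \sum_y \sum_z m y z * (m y z)^*.
  by apply: sumr_ge0 => y _; apply: sumr_ge0 => z _; rewrite mul_conjC_ge0.
pose a y := v (0, y); pose b y := v (1, y).
have E y z : m y z * (m y z)^* =
    a y * (a y)^* * (b z * (b z)^*) - a y * (b y)^* * (b z * (a z)^*)
  - b y * (a y)^* * (a z * (b z)^*) + b y * (b y)^* * (a z * (a z)^*).
  by rewrite /m rmorphB !rmorphM /= /a /b; ring.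
under eq_bigr => y _.
  under eq_bigr => z _ do rewrite E.
  rewrite big_split !sumrB /= -!mulr_sumr.
  over.
rewrite big_split !sumrB /= -!mulr_suml /det_red /red_pure -/a -/b.
by rewrite /a /b; under [in RHS]eq_bigr => y _ do rewrite -conjcE; ring.
Qed.

Lemma Re_det_red v : (complex.Re (det_red v))%:C%C = det_red v.
Proof. by rewrite RRe_real ?ger0_real ?det_red_ge0. Qed.

Lemma Re_det_red_ge0 v : 0 <= complex.Re (det_red v).
Proof. by rewrite -ler0c Re_det_red det_red_ge0. Qed.

Lemma sqr_conc_vec v : conc_vec v ^+ 2 = 4 * complex.Re (det_red v).
Proof.
by rewrite /conc_vec exprMn sqr_sqrtr ?Re_det_red_ge0 // -natrX.
Qed.

Lemma sqnorm_ge0 v : 0 <= sqnorm v.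
Proof. by apply: sumr_ge0 => i _; rewrite mulrC mul_conjC_ge0. Qed.

Lemma sqnorm_eq0 v : sqnorm v = 0 -> forall i, v i = 0.
Proof.
move=> /eqP; rewrite psumr_eq0 => [/allP H i|i _]; last by rewrite mulrC mul_conjC_ge0.
by have := H i (mem_index_enum _); rewrite mulrC mul_conjC_eq0 => /eqP.
Qed.

Lemma det_redZ (a : C) v : det_red (fun i => a * v i) = (a * a^*) ^+ 2 * det_red v.
Proof.
have E x x' : red_pure (fun i => a * v i) x x' = a * a^* * red_pure v x x'.
  rewrite /red_pure mulr_sumr; apply: eq_bigr => y _.
  by rewrite !conjcE rmorphM /= mulrACA.
by rewrite /det_red !E; ring.
Qed.

Lemma conc_vecZ (a : R) v : conc_vec (fun i => a%:C%C * v i) = a ^+ 2 * conc_vec v.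
Proof.
rewrite /conc_vec det_redZ conjC_real -Re_det_red -!rmorphM -!rmorphXn -!rmorphM /=.
rewrite -expr2 sqrtrM ?sqr_ge0 // sqrtr_sqr ger0_norm ?sqr_ge0 //.
by rewrite mulrCA.
Qed.

(** A two-by-two matrix satisfies tr (rho^2) = (tr rho)^2 - 2 det rho, so trace 1 gives 2 (1 - tr
    (rho^2)) = 4 det rho. *)
Lemma conc_pure_conc_vec v : unit_vec v -> conc_pure v = conc_vec v.
Proof.
move=> v1.
have tr1 : red_pure v 0 0 + red_pure v 1 1 = 1.
  rewrite -[RHS]v1 sum_pairE /red_pure; congr (_ + _);
  by apply: eq_bigr => y _; rewrite mulrC.
rewrite /conc_pure /conc_vec.
have -> : \sum_x \sum_x' red_pure v x x' * red_pure v x' x = 1 - 2 * det_red v.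
  transitivity ((red_pure v 0 0 + red_pure v 1 1) ^+ 2 - 2 * det_red v).
    by rewrite !sum2 /det_red; ring.
  by rewrite tr1 expr1n.
rewrite -Re_det_red -(rmorph_nat (real_complex R)) -rmorphM -rmorphB /=.
set d := complex.Re _.
have -> : 2 * (1 - (1 - 2 * d)) = 2 ^+ 2 * d by ring.
by rewrite sqrtrM ?sqr_ge0 // sqrtr_sqr ger0_norm.
Qed.

(** A vector becomes a weight, its squared norm, and a unit vector; the cost is kept as [conc_vec]
    is homogeneous of degree two. Zero vectors have no direction and are filtered out. *)
Lemma vectors_ensemble rho (s : seq ('I_2 * Y -> C)) :
  (forall x x', rho x x' = \sum_(v <- s) Defs.proj v x x') -> trace rho = 1 ->
  exists e, ensemble rho e /\
    \sum_(q <- e) q.1 * conc_pure q.2 = \sum_(v <- s) conc_vec v.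
Proof.
move=> rhoE tr1.
pose N v : R := complex.Re (sqnorm v).
have NE v : (N v)%:C%C = sqnorm v by rewrite RRe_real ?ger0_real ?sqnorm_ge0.
have N0 v : 0 <= N v by rewrite -ler0c NE sqnorm_ge0.
pose nv v : 'I_2 * Y -> C := fun i => ((Num.sqrt (N v))^-1)%:C%C * v i.
pose f v := (N v, nv v).
pose e := [seq f v | v <- s & N v != 0].
have invE v : N v != 0 -> N v * ((Num.sqrt (N v))^-1) ^+ 2 = 1.
  by move=> nz; rewrite exprVn sqr_sqrtr // mulfV.
have nvu v : N v != 0 -> unit_vec (nv v).
  move=> nz; rewrite /unit_vec.
  transitivity ((((Num.sqrt (N v))^-1) ^+ 2)%:C%C * sqnorm v).
    rewrite /sqnorm mulr_sumr; apply: eq_bigr => i _.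
    by rewrite /nv conjcE rmorphM /= conjC_real rmorphXn /=; ring.
  by rewrite -NE -rmorphM /= mulrC invE.
have nv0 v i : N v = 0 -> v i = 0.
  by move=> z; apply: sqnorm_eq0; rewrite -NE z.
exists e; split; first split.
- by move=> q /mapP[v]; rewrite mem_filter => /andP[nz _] ->; split; [exact: N0 | exact: nvu].
- split.
    apply: (@complexI R); rewrite rmorph1 -tr1 /trace.
    under [in RHS]eq_bigr => i _ do rewrite rhoE.
    rewrite exchange_big /= big_map big_filter big_mkcond rmorph_sum /=.
    apply: eq_bigr => v _; case: eqVneq => nz.
      by rewrite rmorph0 big1 // => i _; rewrite /Defs.proj nv0 // mul0r.
    by rewrite NE; apply: eq_bigr => i _; rewrite /Defs.proj conjcE mulrC.
  move=> i j; rewrite rhoE big_map big_filter [RHS]big_mkcond.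
  apply: eq_bigr => v _; case: eqVneq => nz /=.
    by rewrite /Defs.proj nv0 // mul0r.
  rewrite /Defs.proj /nv !conjcE rmorphM /= conjC_real.
  transitivity ((N v * ((Num.sqrt (N v))^-1) ^+ 2)%:C%C * (v i * (v j)^*)).
    by rewrite invE // mul1r.
  by rewrite !rmorphM /=; ring.
- rewrite big_map big_filter big_mkcond; apply: eq_bigr => v _ /=.
  case: eqVneq => nz /=.
    have r0 x x' : red_pure v x x' = 0.
      by rewrite /red_pure big1 // => y _; rewrite (nv0 v) // mul0r.
    by rewrite /conc_vec /det_red !r0 mulr0 subrr sqrtr0 mulr0.
  rewrite conc_pure_conc_vec; last exact: nvu.
  by rewrite (conc_vecZ (Num.sqrt (N v))^-1 v) mulrA invE // mul1r.
Qed.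

Lemma ensemble_cost_lbound rho :
  lbound [set s | exists e, ensemble rho e /\
                 s = \sum_(q <- e) q.1 * conc_pure q.2]%classic (0 : R).
Proof.
move=> _ [e [[e0 _] ->]]; rewrite big_seq; apply: sumr_ge0 => q qe.
by have [q0 _] := e0 q qe; rewrite mulr_ge0 // sqrtr_ge0.
Qed.

(** Valid for every operator: one without ensembles has concurrence 0, the value of [inf] at the
    empty set. *)
Lemma conc_ge0 rho : 0 <= conc rho.
Proof.
have [[x Sx]|S0] := pselect (exists x, exists e, ensemble rho e /\
                 x = \sum_(q <- e) q.1 * conc_pure q.2).
  by apply: lb_le_inf; [exists x | exact: ensemble_cost_lbound].
rewrite /conc (_ : [set s | _]%classic = set0) ?inf0 //.
by apply/seteqP; split => // x Sx; apply: S0; exists x.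
Qed.

Lemma conc_le_vectors rho (s : seq ('I_2 * Y -> C)) :
  (forall x x', rho x x' = \sum_(v <- s) Defs.proj v x x') -> trace rho = 1 ->
  conc rho <= \sum_(v <- s) conc_vec v.
Proof.
move=> rhoE tr1; have [e [ee <-]] := vectors_ensemble rhoE tr1.
apply: ge_inf; last by exists e.
by exists 0; exact: ensemble_cost_lbound.
Qed.

(** The spectral decomposition provides one. A lower bound on all costs bounds [conc] only once some
    ensemble exists. *)
Lemma psd_has_ensemble rho : density rho -> exists e, ensemble rho e.
Proof.
move=> [psdrho tr1]; have [u [r [r0 _ _ rhoE]]] := psd_spectral erefl psdrho.
have [|e [ee _]] := @vectors_ensemble rho
  [seq (fun i => (Num.sqrt (r k))%:C%C * u k i) | k <- enum 'I_#|{: 'I_2 * Y}|] _ tr1.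
  move=> x x'; rewrite rhoE big_map big_enum; apply: eq_bigr => k _.
  rewrite /Defs.proj conjcE rmorphM /= conjC_real -{1}(sqr_sqrtr (r0 k)) rmorphXn /=.
  by ring.
by exists e.
Qed.
End Concurrence.

(** * Monogamy for pure states *)

Section Monogamy.
Variable R : realType.
Local Notation C := R[i].

(** H has eigenvalues 1 and -1, with spectral projections b b^* = (1 + H) / 2 and c c^* = (1 - H) /
    2. The vector b is the normalised first column of (1 + H) / 2, which vanishes exactly when h =
    -1, a case treated apart. *)
Lemma traceless_involution_eigenbasis (H : 'M[C]_2) :
  H ^t* = H -> \tr H = 0 -> \det H = -1 ->
  exists b c : 'I_2 -> C,
    (forall i j, b i * (b j)^* + c i * (c j)^* = (i == j)%:R) /\
    (forall i j, b i * (b j)^* - c i * (c j)^* = H i j).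
Proof.
move=> HH trH detH.
have HE i j : (H i j)^* = H j i by rewrite -[in RHS]HH !mxE.
have H00 : H 0 0 \is Num.real by apply/CrealP; exact: HE.
pose h := complex.Re (H 0 0); pose g := H 0 1.
have hE : H 0 0 = h%:C%C by rewrite /h RRe_real.
have H11 : H 1 1 = - h%:C%C.
  by apply/eqP; rewrite -addr_eq0 addrC -hE -trace2 trH.
have H10 : H 1 0 = g^* by rewrite HE.
have gg : g * g^* = 1 - h%:C%C ^+ 2.
  by move: detH; rewrite det2 hE H11 H10 -/g => e; rewrite -[1]opprK -e; ring.
have h1 : 0 <= 1 - h ^+ 2.
  by rewrite -ler0c rmorphB rmorph1 rmorphXn /= -gg mul_conjC_ge0.
have all2 (P : 'I_2 -> 'I_2 -> Prop) : P 0 0 -> P 0 1 -> P 1 0 -> P 1 1 -> forall i j, P i j.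
  by move=> ? ? ? ? i j; case: (I2P i) => ->; case: (I2P j) => ->.
have [hm|hm] := eqVneq h (-1).
  have g0 : g = 0.
    apply/eqP; rewrite -mul_conjC_eq0 gg hm rmorphN rmorph1 sqrrN expr1n.
    by rewrite subrr.
  exists (fun i => (i == 1)%:R), (fun i => (i == 0)%:R); split; apply: all2;
    rewrite ?hE ?H11 ?H10 -/g ?g0 ?hm /= ?rmorph1 ?rmorph0 ?rmorphN ?rmorph1;
    ring.
pose s := Num.sqrt ((1 + h) / 2).
have hp : 0 < 1 + h by nra.
have s0 : s%:C%C != 0 :> C.
  by rewrite (_ : 0 = (0 : R)%:C%C) // (inj_eq (@complexI R)) gt_eqF // sqrtr_gt0 divr_gt0.
have ss : s%:C%C * s%:C%C = (1 + h%:C%C) / 2.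
  rewrite -rmorphM /= -expr2 sqr_sqrtr ?divr_ge0 ?(ltW hp) //.
  by rewrite rmorphM rmorphD /= rmorph1 fmorphV rmorph_nat.
have e1 : (g^* / (2 * s%:C%C)) * (g / (2 * s%:C%C)) = (1 - h%:C%C) / 2.
  have -> : (g^* / (2 * s%:C%C)) * (g / (2 * s%:C%C)) =
            (g * g^*) / (4 * (s%:C%C * s%:C%C)) by field.
  rewrite gg ss; field.
  by rewrite -(rmorph1 (real_complex R)) -rmorphD (_ : 0 = (0 : R)%:C%C) //
       (inj_eq (@complexI R)) gt_eqF.
have e2 : s%:C%C * (g / (2 * s%:C%C)) = g / 2 by field.
have e3 : s%:C%C * (g^* / (2 * s%:C%C)) = g^* / 2 by field.
have c2 : (2 * s%:C%C : C)^* = 2 * s%:C%C.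
  by rewrite rmorphM /= conjC_real rmorph_nat.
exists (fun i => if i == 0 then s%:C%C else g^* / (2 * s%:C%C)).
exists (fun i => if i == 0 then - (g / (2 * s%:C%C)) else s%:C%C).
have gv : (g / (2 * s%:C%C))^* = g^* / (2 * s%:C%C) by rewrite -[in RHS]c2; exact: fmorph_div.
have gv' : (g^* / (2 * s%:C%C))^* = g / (2 * s%:C%C).
  by rewrite -[in RHS]c2 -{2}[g]conjCK; exact: fmorph_div.
split; apply: all2 => /=; rewrite ?rmorphN /= ?gv ?gv' ?conjC_real ?hE ?H11 ?H10 -/g;
  rewrite ?mulrN ?mulNr ?opprK ?[_ / _ * s%:C%C]mulrC ?e2 ?e3 ?ss ?e1
    ?[g / _ * _]mulrC ?e1; by field.
Qed.

(** The reduced state is M M^* for M = [vmx v], so its determinant is |det M|^2. *)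
Lemma conc_vec_qubits (v : 'I_2 * 'I_2 -> C) : (conc_vec v)%:C%C = 2 * `|\det (vmx v)|.
Proof.
have E : det_red v = `|\det (vmx v)| ^+ 2.
  rewrite /det_red /red_pure !sum2 normCK det2 !mxE rmorphB !rmorphM /=.
  by rewrite !conjcE; ring.
have nr : (complex.Re `|\det (vmx v)|)%:C%C = `|\det (vmx v)|.
  by rewrite RRe_real // normr_real.
rewrite -nr in E *.
have : complex.Re (det_red v) = complex.Re `|\det (vmx v)| ^+ 2.
  by apply: (@complexI R); rewrite Re_det_red E rmorphXn.
rewrite /conc_vec => ->.
have n0 : 0 <= complex.Re `|\det (vmx v)| by rewrite -ler0c nr.
by rewrite sqrtr_sqr ger0_norm // rmorphM rmorph_nat.
Qed.

(** Minkowski's inequality in the plane, by Lagrange's identity; it lets the bounds for pure states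
    be added along an ensemble. *)
Lemma sum_sqr_le_triangle (a1 a2 b1 b2 c1 c2 : R) : 0 <= c1 -> 0 <= c2 ->
  a1 ^+ 2 + b1 ^+ 2 <= c1 ^+ 2 -> a2 ^+ 2 + b2 ^+ 2 <= c2 ^+ 2 ->
  (a1 + a2) ^+ 2 + (b1 + b2) ^+ 2 <= (c1 + c2) ^+ 2.
Proof.
move=> c10 c20 h1 h2.
have h3 : (a1 * a2 + b1 * b2) ^+ 2 <= (c1 * c2) ^+ 2.
  rewrite exprMn.
  have : (a1 ^+ 2 + b1 ^+ 2) * (a2 ^+ 2 + b2 ^+ 2) <= c1 ^+ 2 * c2 ^+ 2.
    by rewrite ler_pM // addr_ge0 // sqr_ge0.
  apply: le_trans.
  have -> : (a1 ^+ 2 + b1 ^+ 2) * (a2 ^+ 2 + b2 ^+ 2) =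
    (a1 * a2 + b1 * b2) ^+ 2 + (a1 * b2 - a2 * b1) ^+ 2 by ring.
  by rewrite lerDl sqr_ge0.
have h4 : a1 * a2 + b1 * b2 <= c1 * c2.
  rewrite (le_trans (ler_norm _)) // -(@ler_pXn2r _ 2) ?nnegrE ?mulr_ge0 //.
  by rewrite real_normK ?num_real.
by rewrite !sqrrD; lra.
Qed.

Section Pure.
Variable Y : finType.
Implicit Types (phi : 'I_2 * ('I_2 * Y) -> C).

Definition red12_pure phi : op R ('I_2 * 'I_2)%type :=
  fun x x' => \sum_c phi (x.1, (x.2, c)) * (phi (x'.1, (x'.2, c)))^*.

Definition red13_pure phi : op R ('I_2 * Y)%type :=
  fun x x' => \sum_b phi (x.1, (b, x.2)) * (phi (x'.1, (b, x'.2)))^*.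

Lemma psd_red12_pure phi : psd (red12_pure phi).
Proof.
move=> v.
have -> : \sum_i \sum_j conjc (v i) * red12_pure phi i j * v j =
  \sum_c (\sum_i (v i)^* * phi (i.1, (i.2, c))) *
         (\sum_i (v i)^* * phi (i.1, (i.2, c)))^*.
  under [in RHS]eq_bigr => c _.
    rewrite rmorph_sum mulr_suml.
    under eq_bigr => i _ do rewrite mulr_sumr.
    over.
  rewrite [in RHS]exchange_big; apply: eq_bigr => i _.
  rewrite [in RHS]exchange_big; apply: eq_bigr => j _.
  rewrite /red12_pure mulr_sumr mulr_suml; apply: eq_bigr => c _.
  by rewrite rmorphM /= conjCK conjcE; ring.
by apply: sumr_ge0 => c _; exact: mul_conjC_ge0.
Qed.

(** The reduced states of psi b and psi c have sum rho_1 and difference F, so the parallelogram law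
    for det gives 2 (det rho_b + det rho_c) = det rho_1 + det F. As - det F >= kap^2, the total
    concurrence of [t] has square at most 4 det rho_1 - 4 kap^2, while that of [s] is at most 2 kap
    + delta. *)
Lemma pure_monogamy phi (delta : R) : 0 < delta ->
  exists (s : seq ('I_2 * 'I_2 -> C)) (t : seq ('I_2 * Y -> C)),
    [/\ forall x x', red12_pure phi x x' = \sum_(v <- s) Defs.proj v x x',
        forall x x', red13_pure phi x x' = \sum_(v <- t) Defs.proj v x x'
      & (\sum_(v <- s) conc_vec v) ^+ 2 + (\sum_(v <- t) conc_vec v) ^+ 2 <=
        (conc_vec phi + delta) ^+ 2].
Proof.
move=> delta0.
have d20 : 0 < delta / 2 by rewrite divr_gt0.
have [s [H [kap [sE [HH trH detH] kap0 sk kF]]]] :=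
  exists_ensemble_direction (psd_red12_pure phi) d20.
have [b [c [bc1 bcH]]] := traceless_involution_eigenbasis HH trH detH.
(* The states left by measuring the second qubit in the basis b, c. *)
pose psi (f : 'I_2 -> C) (x : 'I_2 * Y) := \sum_i phi (x.1, (i, x.2)) * f i.
exists s, [:: psi b; psi c]; split.
- exact: sE.
- move=> x x'; rewrite !big_cons big_nil addr0 /Defs.proj /psi !conjcE !sum2.
  rewrite !rmorphD !rmorphM /=.
  have e00 := bc1 0 0; have e01 := bc1 0 1; have e10 := bc1 1 0; have e11 := bc1 1 1.
  rewrite /= in e00 e01 e10 e11.
  rewrite /red13_pure sum2.
  set p0 := phi (x.1, (0, _)); set p1 := phi (x.1, (1, _)).
  set q0 := (phi (x'.1, (0, _)))^*; set q1 := (phi (x'.1, (1, _)))^*.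
  transitivity (p0 * q0 * (b 0 * (b 0)^* + c 0 * (c 0)^*) +
                p0 * q1 * (b 0 * (b 1)^* + c 0 * (c 1)^*) +
                p1 * q0 * (b 1 * (b 0)^* + c 1 * (c 0)^*) +
                p1 * q1 * (b 1 * (b 1)^* + c 1 * (c 1)^*)); last by ring.
  by rewrite e00 e01 e10 e11; ring.
set F := \matrix_(a, a') _ in kF.
have redE (f g : 'I_2 -> C) a a' :
    \sum_y psi f (a, y) * (psi g (a', y))^* =
    \sum_i \sum_j red12_pure phi (a, i) (a', j) * (f i * (g j)^*).
  transitivity (\sum_y \sum_i \sum_j
     phi (a, (i, y)) * (phi (a', (j, y)))^* * (f i * (g j)^*)).
    apply: eq_bigr => y _; rewrite /psi rmorph_sum mulr_suml.
    apply: eq_bigr => i _; rewrite mulr_sumr; apply: eq_bigr => j _.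
    by rewrite rmorphM /= mulrACA.
  rewrite exchange_big; apply: eq_bigr => i _.
  rewrite exchange_big; apply: eq_bigr => j _.
  by rewrite /red12_pure mulr_suml.
have plus a a' : red_pure (psi b) a a' + red_pure (psi c) a a' = red_pure phi a a'.
  have -> : red_pure phi a a' =
      \sum_i \sum_j red12_pure phi (a, i) (a', j) * (i == j)%:R.
    rewrite /red_pure sum_pairE /red12_pure !sum2 /= !(mulr0, mulr1, addr0, add0r).
    by [].
  rewrite {1 2}/red_pure !redE -big_split; apply: eq_bigr => i _.
  by rewrite -big_split; apply: eq_bigr => j _; rewrite /= -mulrDr bc1.
have minus a a' : red_pure (psi b) a a' - red_pure (psi c) a a' = F a a'.
  rewrite {1 2}/red_pure !redE -sumrB mxE; apply: eq_bigr => i _.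
  by rewrite -sumrB; apply: eq_bigr => j _; rewrite /= -mulrBr bcH.
have detsum : 2 * (det_red (psi b) + det_red (psi c)) = det_red phi + \det F.
  by rewrite det2 -!minus {3}/det_red -!plus /det_red; ring.
set dphi := complex.Re (det_red phi).
set db := complex.Re (det_red (psi b)); set dc := complex.Re (det_red (psi c)).
have db0 : 0 <= db := Re_det_red_ge0 _; have dc0 : 0 <= dc := Re_det_red_ge0 _.
have dets : 2 * (db + dc) <= dphi - kap ^+ 2.
  rewrite -lecR rmorphM rmorph_nat rmorphD rmorphB rmorphXn /= !Re_det_red detsum.
  by rewrite lerD2l lerNr.
have tp0 := conc_vec_ge0 phi.
have tphi : conc_vec phi ^+ 2 = 4 * dphi by rewrite sqr_conc_vec.
have tb : conc_vec (psi b) ^+ 2 = 4 * db by rewrite sqr_conc_vec.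
have tc : conc_vec (psi c) ^+ 2 = 4 * dc by rewrite sqr_conc_vec.
have sl : \sum_(v <- s) conc_vec v <= 2 * kap + delta.
  rewrite -lecR rmorph_sum /=.
  under eq_bigr => v _ do rewrite conc_vec_qubits.
  rewrite -mulr_sumr.
  have -> : (2 * kap + delta)%:C%C = 2 * (kap + delta / 2)%:C%C :> C.
    by rewrite -(rmorph_nat (real_complex R)) -rmorphM /=; congr (_%:C)%C; field.
  by rewrite ler_pM2l ?ltr0n.
have s0 : 0 <= \sum_(v <- s) conc_vec v by apply: sumr_ge0 => v _; exact: conc_vec_ge0.
rewrite !big_cons big_nil addr0.
(* Absorbs the cross term 4 kap delta of (2 kap + delta)^2 into that of the right-hand side. *)
have kt : 2 * kap <= conc_vec phi.
  have : (2 * kap) ^+ 2 <= conc_vec phi ^+ 2 by rewrite tphi exprMn; lra.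
  by rewrite ler_pXn2r ?nnegrE //; lra.
have h1 : (\sum_(v <- s) conc_vec v) ^+ 2 <= (2 * kap + delta) ^+ 2.
  by rewrite ler_pXn2r ?nnegrE // addr_ge0 ?mulr_ge0 // ltW.
have h2 : (conc_vec (psi b) + conc_vec (psi c)) ^+ 2 <= 8 * (db + dc).
  have := sqr_ge0 (conc_vec (psi b) - conc_vec (psi c)).
  by rewrite sqrrB sqrrD tb tc; lra.
apply: (@le_trans _ _ ((2 * kap + delta) ^+ 2 + 8 * (db + dc))); first exact: lerD.
have h3 : 4 * kap * delta <= 2 * conc_vec phi * delta by rewrite ler_pM2r //; lra.
by rewrite !sqrrD tphi; lra.
Qed.
End Pure.
End Monogamy.

(** * Monogamy for mixed states *)

Section MixedMonogamy.
Variables (R : realType) (Y : finType).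
Local Notation C := R[i].

Lemma sum_conc_vec_ge0 (Z : finType) (s : seq ('I_2 * Z -> C)) :
  0 <= \sum_(v <- s) conc_vec v.
Proof. by apply: sumr_ge0 => v _; exact: conc_vec_ge0. Qed.

(** Induction on the family: half of delta goes to the head and half to the tail, and
    [sum_sqr_le_triangle] combines the two bounds. *)
Lemma vectors_monogamy (L : seq ('I_2 * ('I_2 * Y) -> C)) (delta : R) : 0 < delta ->
  exists (s : seq ('I_2 * 'I_2 -> C)) (t : seq ('I_2 * Y -> C)),
    [/\ forall x x', \sum_(phi <- L) red12_pure phi x x' =
                     \sum_(v <- s) Defs.proj v x x',
        forall x x', \sum_(phi <- L) red13_pure phi x x' =
                     \sum_(v <- t) Defs.proj v x x'
      & (\sum_(v <- s) conc_vec v) ^+ 2 + (\sum_(v <- t) conc_vec v) ^+ 2 <=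
        (\sum_(phi <- L) conc_vec phi + delta) ^+ 2].
Proof.
elim: L delta => [|phi L IH] delta delta0.
  exists [::], [::]; split=> [x x'|x x'|]; rewrite ?big_nil //.
  by rewrite expr0n /= !add0r sqr_ge0.
have d20 : 0 < delta / 2 by rewrite divr_gt0.
have [s1 [t1 [s1E t1E st1]]] := pure_monogamy phi d20.
have [s2 [t2 [s2E t2E st2]]] := IH _ d20.
exists (s1 ++ s2), (t1 ++ t2); split.
- by move=> x x'; rewrite big_cons big_cat s1E s2E.
- by move=> x x'; rewrite big_cons big_cat t1E t2E.
- rewrite !big_cat big_cons /=.
  have -> : conc_vec phi + \sum_(j <- L) conc_vec j + delta =
    (conc_vec phi + delta / 2) + (\sum_(j <- L) conc_vec j + delta / 2) by field.
  apply: sum_sqr_le_triangle => //; rewrite addr_ge0 ?(ltW d20) ?conc_vec_ge0 //.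
  exact: sum_conc_vec_ge0.
Qed.

Lemma sum_assoc (F : 'I_2 * 'I_2 * Y -> C) :
  \sum_i F i = \sum_(j : 'I_2 * ('I_2 * Y)) F (j.1, j.2.1, j.2.2).
Proof.
rewrite (reindex (fun j : 'I_2 * ('I_2 * Y) => (j.1, j.2.1, j.2.2))) //.
by exists (fun i => (i.1.1, (i.1.2, i.2))) => [[a [b c]]|[[a b] c]].
Qed.

Lemma density_cut1 (rho : op R ('I_2 * 'I_2 * Y)%type) :
  density rho -> density (cut1 rho).
Proof.
move=> [psdrho tr1]; split; last by rewrite -tr1 /trace sum_assoc.
move=> v; have := psdrho (fun i => v (i.1.1, (i.1.2, i.2))); congr (0 <= _).
rewrite sum_assoc; apply: eq_bigr => -[a [b c]] _.
by rewrite sum_assoc; apply: eq_bigr => -[a' [b' c']] _.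
Qed.

Lemma trace_red12 (rho : op R ('I_2 * 'I_2 * Y)%type) : trace (red12 rho) = trace rho.
Proof.
rewrite /trace /red12 pair_bigA /=; apply: eq_bigr => -[[a b] c] _ //.
Qed.

Lemma trace_red13 (rho : op R ('I_2 * 'I_2 * Y)%type) : trace (red13 rho) = trace rho.
Proof.
rewrite /trace /red13 sum_assoc.
rewrite -(pair_bigA _ (fun a c => \sum_b rho (a, b, c) (a, b, c))) /=.
rewrite -(pair_bigA _ (fun a j => rho (a, j.1, j.2) (a, j.1, j.2))) /=.
apply: eq_bigr => a _; rewrite exchange_big /=.
by rewrite (pair_bigA _ (fun b c => rho (a, b, c) (a, b, c))).
Qed.

Lemma ensemble_monogamy (rho : op R ('I_2 * 'I_2 * Y)%type) e :
  trace rho = 1 -> ensemble (cut1 rho) e ->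
  conc (red12 rho) ^+ 2 + conc (red13 rho) ^+ 2 <=
  (\sum_(q <- e) q.1 * conc_pure q.2) ^+ 2.
Proof.
move=> tr1 [e0 [_ rhoE]].
(* The square root of each weight is absorbed into its vector. *)
pose f (q : R * ('I_2 * ('I_2 * Y) -> C)) := fun i => (Num.sqrt q.1)%:C%C * q.2 i.
have cost : \sum_(q <- e) q.1 * conc_pure q.2 = \sum_(phi <- map f e) conc_vec phi.
  rewrite big_map !big_seq; apply: eq_bigr => q /e0 [q0 qu].
  by rewrite /f conc_vecZ sqr_sqrtr // conc_pure_conc_vec.
have cutE x x' : cut1 rho x x' = \sum_(phi <- map f e) phi x * (phi x')^*.
  rewrite rhoE big_map !big_seq; apply: eq_bigr => q /e0 [q0 _].
  rewrite /f /Defs.proj conjcE rmorphM /= conjC_real -{1}(sqr_sqrtr q0) rmorphXn /=.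
  by ring.
rewrite cost; set S := \sum_(phi <- _) _.
have S0 : 0 <= S := sum_conc_vec_ge0 _.
have main delta : 0 < delta ->
  conc (red12 rho) ^+ 2 + conc (red13 rho) ^+ 2 <= (S + delta) ^+ 2.
  move=> d0; have [s [t [sE tE st]]] := vectors_monogamy (map f e) d0.
  apply: le_trans st; apply: lerD.
    rewrite ler_pXn2r ?nnegrE ?conc_ge0 ?sum_conc_vec_ge0 //.
    apply: conc_le_vectors; last by rewrite trace_red12.
    move=> x x'; rewrite -sE /red12 /red12_pure exchange_big /=.
    by apply: eq_bigr => c _; rewrite -cutE.
  rewrite ler_pXn2r ?nnegrE ?conc_ge0 ?sum_conc_vec_ge0 //.
  apply: conc_le_vectors; last by rewrite trace_red13.
  move=> x x'; rewrite -tE /red13 /red13_pure exchange_big /=.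
  by apply: eq_bigr => c _; rewrite -cutE.
(* Passage to delta = 0: a failure is refuted by taking for delta half the gap between the square
   root of [Q] and [S]. *)
rewrite leNgt; apply/negP => lt.
set Q := _ + _ in main lt.
have Q0 : 0 < Q by apply: le_lt_trans lt; rewrite sqr_ge0.
have SQ : S < Num.sqrt Q.
  by rewrite -(ger0_norm S0) -sqrtr_sqr ltr_sqrt.
have d0 : 0 < (Num.sqrt Q - S) / 2 by rewrite divr_gt0 // subr_gt0.
have := main _ d0; rewrite leNgt => /negP; apply.
rewrite -[ltRHS]sqr_sqrtr ?(ltW Q0) // ltr_pXn2r ?nnegrE ?sqrtr_ge0 ?(addr_ge0 S0 (ltW d0)) //.
by lra.
Qed.

(** The Coffman-Kundu-Wootters inequality, with a third party of any finite dimension: the bound for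
    each ensemble of the cut passes to the infimum. *)
Lemma monogamy (rho : op R ('I_2 * 'I_2 * Y)%type) : density rho ->
  conc (red12 rho) ^+ 2 + conc (red13 rho) ^+ 2 <= conc (cut1 rho) ^+ 2.
Proof.
move=> dens; set Q := leLHS.
have Q0 : 0 <= Q by rewrite addr_ge0 ?sqr_ge0.
rewrite -(sqr_sqrtr Q0) ler_pXn2r ?nnegrE ?sqrtr_ge0 ?conc_ge0 //.
apply: lb_le_inf.
  have [e ee] := psd_has_ensemble (density_cut1 dens).
  by exists (\sum_(q <- e) q.1 * conc_pure q.2), e.
move=> _ [e [ee ->]]; have [_ tr1] := dens.
have c0 : 0 <= \sum_(q <- e) q.1 * conc_pure q.2.
  by apply: (ensemble_cost_lbound (rho := cut1 rho)); exists e.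
by rewrite -(ger0_norm c0) -sqrtr_sqr ler_wsqrtr // ensemble_monogamy.
Qed.
End MixedMonogamy.

Import numFieldNormedType.Exports.

(** * Inequalities between real powers *)

Section PowerInequality.
Variable R : realType.
Implicit Types (a b c k p s t x y : R).

(** One factor is split off, a^y = a a^(y-1), and the power y - 1 >= 0 is monotone. *)
Lemma powR_superadd a b y : 0 <= a -> 0 <= b -> 1 <= y ->
  a `^ y + b `^ y <= (a + b) `^ y.
Proof.
move=> a0 b0 y1; have y0 : 0 < y by exact: lt_le_trans y1.
have ab0 : 0 <= a + b by exact: addr_ge0.
have y10 : 0 <= y - 1 by rewrite subr_ge0.
rewrite -(mulr_powRB1 a0 y0) -(mulr_powRB1 b0 y0) -(mulr_powRB1 ab0 y0) mulrDl.
by apply: lerD; apply: ler_wpM2l => //; apply: ge0_ler_powR; rewrite ?nnegrE //;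
  rewrite ?lerDl ?lerDr.
Qed.

(** Young's inequality for the product of (1 + t)^x and 1, with exponents 1/x and 1/(1 - x). *)
Lemma powR_bernoulli t x : 0 <= t -> 0 < x -> x < 1 -> (1 + t) `^ x <= 1 + x * t.
Proof.
move=> t0 x0 x1.
have t1 : 0 <= 1 + t by rewrite addr_ge0.
have x1' : 0 < 1 - x by rewrite subr_gt0.
have ix0 : 0 < x^-1 by rewrite invr_gt0.
have ix1 : 0 < (1 - x)^-1 by rewrite invr_gt0.
have eqn : x^-1^-1 + (1 - x)^-1^-1 = 1 by rewrite !invrK subrKC.
have := conjugate_powR (powR_ge0 (1 + t) x) ler01 ix0 ix1 eqn.
rewrite mulr1 -powRrM mulfV ?gt_eqF // powRr1 // powR1 !invrK mul1r.
by move/le_trans; apply; rewrite le_eqVlt; apply/orP; left; apply/eqP; ring.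
Qed.

Lemma half_le_powR p x : 1 / 2 <= p <= 1 -> 0 <= x <= 1 -> 1 / 2 <= p `^ x.
Proof.
move=> /andP[p2 p1] /andP[x0 x1]; apply: (le_trans p2).
apply: ger1_powR => //; rewrite p1 andbT; lra.
Qed.

(** The derivative at u is x times (1 + u)^(x-1) - p^x u^(x-1). For u <= 1 one has 1 + u >= 2 u, and
    x <= 1/2 <= p gives 2^(x-1) <= 2^(-x) <= p^x, so it is not positive. *)
Lemma powR_gap_nincr x p s t : 0 < x -> x <= 1 / 2 -> 1 / 2 <= p <= 1 ->
  0 < s -> s <= t -> t <= 1 ->
  (1 + t) `^ x - p `^ x * t `^ x <= (1 + s) `^ x - p `^ x * s `^ x.
Proof.
move=> x0 x2 p2 s0 st t1.
pose f u := (1 + u) `^ x - p `^ x * u `^ x.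
have df (u : R) : 0 < u ->
    is_derive u 1 f (x * (1 + u) `^ (x - 1) - p `^ x * (x * u `^ (x - 1))).
  move=> u0.
  have u1 : 0 < 1 + u by lra.
  have h1 : is_derive (1 + u) 1 (@powR R ^~ x) (x * (1 + u) `^ (x - 1)).
    exact: is_derive1_powR.
  have h2 : is_derive u 1 (fun v : R => 1 + v) 1.
    rewrite -[X in is_derive _ _ _ X]add0r.
    exact: (is_deriveD (is_derive_cst (1 : R) u 1) (is_derive_id u 1)).
  have h3 := is_derive1_comp h1 h2.
  have h4 : is_derive u 1 (@powR R ^~ x) (x * u `^ (x - 1)).
    exact: is_derive1_powR.
  have h5 := is_deriveZ (p `^ x) h4.
  have h6 := is_deriveB h3 h5.
  by apply: (is_derive_eq h6); rewrite mulr1.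
apply: (@ler0_derive1_nincr R f s t) => //.
- move=> u; rewrite in_itv /= => /andP[su _].
  by have [] := df u (lt_trans s0 su).
- move=> u; rewrite in_itv /= => /andP[su ut].
  have u0 := lt_trans s0 su.
  rewrite derive1E; have [_ ->] := df u u0.
  rewrite mulrCA -mulrBr pmulr_rle0 // subr_le0.
  have u1 : 0 < 1 + u by lra.
  have u2 : 0 < 2 * u by lra.
  apply: (@le_trans _ _ ((2 * u) `^ (x - 1))).
    rewrite -[x - 1]opprB !powRN lef_pV2 ?posrE ?powR_gt0 //.
    by apply: ge0_ler_powR; rewrite ?nnegrE; lra.
  rewrite powRM ?(ltW u0) // ler_wpM2r ?powR_ge0 //.
  apply: (@le_trans _ _ (2 `^ (- x))).
    by apply: ler_powR; [rewrite ler1n | lra].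
  rewrite powRN.
  have -> : (2 `^ x)^-1 = (1 / 2 : R) `^ x.
    have e : (1 / 2 : R) `^ x * 2 `^ x = 1.
      by rewrite -powRM ?divr_ge0 // mulfVK ?pnatr_eq0 // powR1.
    apply: (@mulIf _ (2 `^ x)); first by rewrite gt_eqF // powR_gt0.
    by rewrite e mulVf // gt_eqF // powR_gt0.
  have /andP[p21 p1] := p2.
  by apply: ge0_ler_powR; rewrite ?nnegrE; lra.
- apply: derivable_within_continuous => u; rewrite in_itv /= => /andP[su _].
  by have [] := df u (lt_le_trans s0 su).
Qed.

(** Adds the endpoint s = 0, where u^x is not differentiable: there the claim follows from
    Bernoulli's inequality, x <= 1/2 <= p^x and t <= t^x. *)
Lemma powR_gap x p s t : 0 < x -> x <= 1 / 2 -> 1 / 2 <= p <= 1 ->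
  0 <= s -> s <= t -> t <= 1 ->
  (1 + t) `^ x - p `^ x * t `^ x <= (1 + s) `^ x - p `^ x * s `^ x.
Proof.
move=> x0 x2 p2; rewrite le_eqVlt => /predU1P[<- t0 t1|]; last exact: powR_gap_nincr.
rewrite powR0 ?gt_eqF // mulr0 subr0 addr0 powR1 lerBlDr.
have x1 : x < 1 by lra.
apply: (le_trans (powR_bernoulli t0 x0 x1)); rewrite lerD2l.
have [<-|tn0] := eqVneq 0 t; first by rewrite mulr0 mulr_ge0 ?powR_ge0.
apply: ler_pM => //; first exact: ltW.
  apply: (le_trans x2); apply: half_le_powR => //; apply/andP; split; lra.
by apply: ger1_powR; rewrite ?lt_def ?t0 ?t1 ?andbT 1?eq_sym ?tn0 // ltW.
Qed.

(** After division by b^x this is [powR_gap] at s = a / b and t = 1 / k, the coefficient of b^x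
    being (1 + t)^x - p^x t^x. *)
Lemma weighted_power_ineq x k p a b c : 0 <= x <= 1 / 2 -> 1 <= k ->
  1 / 2 <= p <= 1 -> 0 <= a -> 0 <= b -> k * a <= b -> a + b <= c ->
  p `^ x * a `^ x + ((1 + k) `^ x - p `^ x) / k `^ x * b `^ x <= c `^ x.
Proof.
move=> /andP[x0 x2] k1 p2 a0 b0 kab abc.
have ab0 : 0 <= a + b by exact: addr_ge0.
have k0 : 0 < k by lra.
(* At x = 0 every power is 1, that of 0 included, so both sides equal 1. *)
move: x0; rewrite le_eqVlt => /predU1P[<-|x0].
  by rewrite !powRr0 subrr mul0r mul0r addr0 mul1r.
have abx : (a + b) `^ x <= c `^ x.
  by apply: ge0_ler_powR; rewrite ?nnegrE ?(ltW x0) // (le_trans ab0).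
apply: le_trans abx; move: b0; rewrite le_eqVlt => /predU1P[b0|b0].
  have a00 : a = 0.
    by apply/le_anti; rewrite a0 andbT -(pmulr_rle0 _ k0) b0.
  by rewrite -b0 a00 powR0 ?gt_eqF // !mulr0 addr0 powR_ge0.
have s0 : 0 <= a / b by rewrite divr_ge0 // ltW.
have st : a / b <= k^-1.
  by rewrite ler_pdivrMr // ler_pdivlMl.
have t1 : k^-1 <= 1 by rewrite invf_le1.
have := powR_gap x0 x2 p2 s0 st t1.
have ki0 : 0 <= k^-1 by rewrite invr_ge0 ltW.
have bx0 : 0 < b `^ x by rewrite powR_gt0.
have kx0 : 0 < k `^ x by rewrite powR_gt0.
have ek : k^-1 `^ x = (k `^ x)^-1.
  apply: (@mulIf _ (k `^ x)); first by rewrite gt_eqF.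
  by rewrite -powRM ?(ltW k0) // mulVf ?gt_eqF // powR1 mulVf // gt_eqF.
have e1 : (1 + k^-1) `^ x = (1 + k) `^ x / k `^ x.
  rewrite -ek -powRM ?addr_ge0 ?(ltW k0) //; congr (_ `^ _).
  by field; rewrite gt_eqF.
have e2 : (1 + a / b) `^ x * b `^ x = (a + b) `^ x.
  rewrite -powRM ?addr_ge0 ?(ltW b0) //; congr (_ `^ _).
  by field; rewrite gt_eqF.
have e3 : (a / b) `^ x * b `^ x = a `^ x.
  by rewrite -powRM ?(ltW b0) // divfK // gt_eqF.
have e4 : p `^ x * (a / b) `^ x * b `^ x = p `^ x * a `^ x by rewrite -mulrA e3.
rewrite ek e1 => h.
have {h} := ler_wpM2r (ltW bx0) h.
rewrite [X in _ <= X]mulrBl e2 e4 lerBrDl.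
by apply: le_trans; rewrite lerD2l mulrBl.
Qed.

Lemma powR_sqr_superadd (u v c : R) r : 0 <= u -> 0 <= v -> 0 <= c -> 2 <= r ->
  u ^+ 2 + v ^+ 2 <= c ^+ 2 -> u `^ r + v `^ r <= c `^ r.
Proof.
move=> u0 v0 c0 r2 h.
have E z : 0 <= z -> z `^ r = (z ^+ 2) `^ (r / 2).
  by move=> z0; rewrite -powR_mulrn // -powRrM; congr (_ `^ _); field.
rewrite !E //; apply: (@le_trans _ _ ((u ^+ 2 + v ^+ 2) `^ (r / 2))).
  by apply: powR_superadd; rewrite ?sqr_ge0 //; lra.
by apply: ge0_ler_powR; rewrite ?nnegrE ?addr_ge0 ?sqr_ge0 //; lra.
Qed.

(** [weighted_power_ineq] for the r-th powers, with exponent alpha / r <= 1/2. *)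
Lemma concurrence_power_ineq (u v c k p r alpha : R) :
  0 <= u -> 0 <= v -> 0 <= c -> u ^+ 2 + v ^+ 2 <= c ^+ 2 ->
  1 <= k -> 1 / 2 <= p <= 1 -> 2 <= r -> 0 <= alpha <= r / 2 ->
  k * u `^ r <= v `^ r ->
  p `^ (alpha / r) * u `^ alpha +
    ((1 + k) `^ (alpha / r) - p `^ (alpha / r)) / k `^ (alpha / r) * v `^ alpha
  <= c `^ alpha.
Proof.
move=> u0 v0 c0 h k1 p2 r2 /andP[al0 al2] kuv.
have r0 : 0 < r by lra.
have E z : z `^ alpha = (z `^ r) `^ (alpha / r).
  by rewrite -powRrM; congr (_ `^ _); field; rewrite gt_eqF.
rewrite !E; apply: weighted_power_ineq; rewrite ?powR_ge0 //.
  by rewrite divr_ge0 ?(ltW r0) //= ler_pdivrMr //; lra.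
exact: powR_sqr_superadd.
Qed.
End PowerInequality.

Unset Implicit Arguments.

Theorem theorem1 (R : realType) (n : nat)
  (rho : op R ('I_2 * 'I_2 * 'I_(2 ^ (n - 2)))%type)
  (k p r alpha : R) :
  (3 <= n)%N -> density rho ->
  1 <= k -> 1 / 2 <= p <= 1 -> 2 <= r -> 0 <= alpha <= r / 2 ->
  let l := ((1 + k) `^ (alpha / r) - p `^ (alpha / r)) / k `^ (alpha / r) in
  let C1_23 := conc (cut1 rho) in
  let C12 := conc (red12 rho) in
  let C13 := conc (red13 rho) in
  (C13 `^ r >= k * C12 `^ r ->
     C1_23 `^ alpha >= p `^ (alpha / r) * C12 `^ alpha + l * C13 `^ alpha) /\
  (C12 `^ r >= k * C13 `^ r ->
     C1_23 `^ alpha >= p `^ (alpha / r) * C13 `^ alpha + l * C12 `^ alpha).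
Proof.
move=> _ dens k1 p2 r2 al2 l C1_23 C12 C13.
have mono := monogamy dens.
(* The second claim exchanges the two reduced concurrences, in which monogamy is symmetric. *)
by split=> h; apply: concurrence_power_ineq => //; rewrite ?conc_ge0 // addrC.
Qed.
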